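(* Let $p\in(0,1)$ and let $\mathcal A=(\alpha_1,\dots,\alpha_k)$, $\mathcal B=(\beta_1,\dots,\beta_l)$ be finite real sequences satisfying $$\alpha_1\ge\alpha_2\ge\dots\ge\alpha_k>\frac{p}{1-p},\qquad 1\ge\beta_1\ge\beta_2\ge\dots\ge\beta_l\ge p.$$ Then the coherent systems $\{M_n^{\mathcal A,\varnothing}\}_{n\ge0}$ and $\{M_n^{\varnothing,\mathcal B}\}_{n\ge0}$ are extreme points of the convex set of all coherent systems.
   Context: $\mathbb G^p_n$ is the set of partitions $\lambda=(\lambda_1\ge\dots\ge\lambda_n\ge 0)$ with at most $n$ nonzero parts ($\mathbb G^p_0=\{\varnothing\}$). For $\lambda\in\mathbb G^p_n$, $$G_\lambda^{(0,-p)}(x_1,\dots,x_n)=\frac{\det\left[x_i^{\lambda_j+n-j}(1-p x_i)^{j-1}\right]_{1\le i,j\le n}}{\det\left[x_i^{n-j}\right]_{1\le i,j\le n}},$$ and $1^n$ means that all $n$ variables equal $1$. Write $\mu\preceq\lambda$ if $\lambda_1\ge\mu_1\ge\lambda_2\ge\mu_2\ge\dots$, and set $G^{(0,-p)}_{\lambda/\mu}(1)=(1-p)^{\#\{i\ge 1:\ \mu_i>\lambda_{i+1}\}}$ if $\mu\preceq\lambda$, and $0$ otherwise. A coherent system is a collection $\{M_n\}_{n\ge 0}$ of probability measures $M_n$ on $\mathbb G_n^p$ such that for every $n\ge0$ and $\mu\in\mathbb G_n^p$ $$\sum_{\lambda\in\mathbb G^p_{n+1}}M_{n+1}(\lambda)\frac{G_{\lambda/\mu}^{(0,-p)}(1)G_\mu^{(0,-p)}(1^n)}{G_{\lambda}^{(0,-p)}(1^{n+1})}=M_n(\mu).$$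 Coherent systems form a convex set under taking convex combinations for all $n$ simultaneously. For finite sequences $\mathcal A,\mathcal B$ as in the claim (either may be empty, denoted $\varnothing$), set $$\Phi^{\mathcal A,\mathcal B}(z)=\prod_{i=1}^k\frac{1-\frac{p}{1-p}(z-1)}{1-\alpha_i(z-1)}\prod_{i=1}^l\left(1+\frac{\beta_i-p}{1-p}(z-1)\right)$$ (empty products equal $1$). The coherent system $\{M_n^{\mathcal A,\mathcal B}\}_n$ is defined by $M_0^{\mathcal A,\mathcal B}(\varnothing)=1$ and, for $n\ge1$, by the identity of formal power series in $z_1,\dots,z_n$ $$\sum_{\lambda\in\mathbb G^p_n}M_n^{\mathcal A,\mathcal B}(\lambda)\frac{G_\lambda^{(0,-p)}(z_1,\dots,z_n)}{G_\lambda^{(0,-p)}(1^n)}=\prod_{i=1}^n\Phi^{\mathcal A,\mathcal B}(z_i)$$ (with $\Phi^{\mathcal A,\mathcal B}$ expanded in Taylor series at $0$). *)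

(* Defs.v *)
From HB Require Import structures.
From mathcomp Require Import all_boot all_order all_algebra perm.
From mathcomp Require Import all_classical all_reals all_analysis.
(* The notations of mpoly clash with those of mathcomp-analysis. *)
From mathcomp Require Import -(notations) mpoly.

Set Implicit Arguments.
Unset Strict Implicit.
Unset Printing Implicit Defensive.

Import Order.TTheory GRing.Theory Num.Theory.
Local Open Scope classical_set_scope.
Local Open Scope ring_scope.

Record intpart (n : nat) := IntPart {
  intpart_val :> n.-tuple nat;
  _ : sorted geq intpart_val }.
HB.instance Definition _ n := [isSub for @intpart_val n].
HB.instance Definition _ n := [Choice of intpart n by <:].

(* [part la i] is the (i+1)-st part of la, equal to 0 when i >= n. *)
Definition part n (la : intpart n) (i : nat) : nat := nth 0%N la i.

Lemma alternant_dvd (S : comNzRingType) n (x : 'I_n -> S)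
    (f : 'I_n -> {poly S}) :
  exists g : S,
    \det (\matrix_(i, j) (f j).[x i]) =
    g * \det (\matrix_(i, j < n) x i ^+ (n - j.+1)).
Proof.
pose P := \prod_(i < n) ('X - (x i)%:P).
have mP : P \is monic by apply: monic_prod => i _; exact: monicXsubC.
have sP : size P = n.+1.
  by rewrite size_prod_XsubC -[index_enum _]enumT size_enum_ord.
have Px i : P.[x i] = 0.
  by rewrite horner_prod (bigD1 i) //= hornerXsubC subrr mul0r.
pose r j := Pdiv.Ring.rmodp (f j) P.
have sr j : (size (r j) <= n)%N.
  by rewrite -ltnS -sP Pdiv.Ring.ltn_rmodpN0 // monic_neq0.
have fr i j : (f j).[x i] = (r j).[x i].
  by rewrite {1}[f j](Pdiv.RingMonic.rdivp_eq mP) hornerD hornerM Px mulr0 add0r.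
exists (\det (\matrix_(k, j < n) (r j)`_(n - k.+1))).
rewrite mulrC -det_mulmx; congr (\det _); apply/matrixP => i j.
rewrite !mxE fr (horner_coef_wide _ (sr j)) (reindex_inj rev_ord_inj).
by apply: eq_bigr => k _ /=; rewrite !mxE mulrC.
Qed.

Section Grothendieck.
Variables (R : realType) (p : R).

Local Notation X i := (mpolyX R (mnm1 i)).

(* Columns are indexed from 0, hence the shift of exponents. *)
Definition grothendieck_num n (la : intpart n) : mpoly n R :=
  \det (\matrix_(i, j < n)
          (X i ^+ (part la j + (n - j.+1)) * (1 - p *: X i) ^+ j)).

Definition vandermonde_den n : mpoly n R :=
  \det (\matrix_(i, j < n) X i ^+ (n - j.+1)).

Lemma vandermonde_den_neq0 n : vandermonde_den n != 0.
Proof.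
rewrite /vandermonde_den.
pose Y := Vandermonde n (\row_(i < n) X i).
have -> : \matrix_(i, j < n) X i ^+ (n - j.+1)
          = col_perm (perm rev_ord_inj) Y^T.
  by apply/matrixP => i j; rewrite !mxE permE.
rewrite col_permE det_mulmx det_perm mulf_neq0 ?signr_eq0 //.
rewrite det_tr det_Vandermonde; apply/prodf_neq0 => i _.
apply/prodf_neq0 => j ij; rewrite !mxE subr_eq0; apply/eqP.
move=> /(congr1 (fun q => mcoeff (mnm1 i) q)); rewrite !mcoeffX eqxx.
have /negbTE-> : mnm1 j != mnm1 i.
  apply: contraTN ij => /eqP /(congr1 (fun m : multinom n => m i)).
  by rewrite !mnm1E eqxx; case: eqP => // ->; rewrite ltnn.
by move/eqP; rewrite eq_sym oner_eq0.
Qed.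

Lemma grothendieck_exists n (la : intpart n) :
  exists g : mpoly n R, grothendieck_num la = g * vandermonde_den n.
Proof.
pose f (j : 'I_n) : {poly mpoly n R} :=
  'X ^+ (part la j + (n - j.+1)) * (1 - (p *: 1)%:P * 'X) ^+ j.
have [g gE] := alternant_dvd (fun i : 'I_n => X i) f; exists g; rewrite -gE.
congr (\det _); apply/matrixP => i j; rewrite !mxE /f !hornerE.
by rewrite -scalerAl mul1r.
Qed.

(* [mpoly] has no division: the quotient is the polynomial characterized by
   [grothendieckP] and [grothendieck_uniq]. *)
Definition grothendieck n (la : intpart n) : mpoly n R :=
  sval (cid (grothendieck_exists la)).

Lemma grothendieckP n (la : intpart n) :
  grothendieck_num la = grothendieck la * vandermonde_den n.
Proof. exact: svalP (cid (grothendieck_exists la)). Qed.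

Lemma grothendieck_uniq n (la : intpart n) (g : mpoly n R) :
  grothendieck_num la = g * vandermonde_den n -> g = grothendieck la.
Proof.
by rewrite grothendieckP => /(mulIf (vandermonde_den_neq0 n)).
Qed.

Definition grothendieck1 n (la : intpart n) : R :=
  meval (fun=> 1) (grothendieck la).

(* mu \preceq la; outside the range of i both mu_i and la_{i+1} vanish. *)
Definition interlace n (mu : intpart n) (la : intpart n.+1) : bool :=
  [forall i : 'I_n,
    (part mu i <= part la i)%N && (part la i.+1 <= part mu i)%N].

Definition skew_grothendieck1 n (la : intpart n.+1) (mu : intpart n) : R :=
  if interlace mu la
  then (1 - p) ^+ #|[pred i : 'I_n | (part la i.+1 < part mu i)%N]|
  else 0.

(* A probability measure on the countable set of partitions is given by its
   mass function. *)
Definition is_prob n (m : intpart n -> R) : Prop :=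
  (forall la, 0 <= m la) /\ (\esum_(la in [set: intpart n]) (m la)%:E = 1)%E.

(* For 0 < p < 1 the weights are nonnegative, so [esum] is the usual sum. *)
Definition coherent_system (M : forall n, intpart n -> R) : Prop :=
  (forall n, is_prob (M n)) /\
  (forall n (mu : intpart n),
    (\esum_(la in [set: intpart n.+1])
       (M n.+1 la * (skew_grothendieck1 la mu * grothendieck1 mu
                     / grothendieck1 la))%:E = (M n mu)%:E)%E).

Definition extreme_coherent_system (M : forall n, intpart n -> R) : Prop :=
  coherent_system M /\
  forall (M1 M2 : forall n, intpart n -> R) (t : R),
    coherent_system M1 -> coherent_system M2 -> 0 < t < 1 ->
    (forall n la, M n la = t * M1 n la + (1 - t) * M2 n la) ->
    M1 = M /\ M2 = M.

Definition Phi (A B : seq R) (z : R) : R :=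
  (\prod_(a <- A) ((1 - p / (1 - p) * (z - 1)) / (1 - a * (z - 1)))) *
  (\prod_(b <- B) (1 + (b - p) / (1 - p) * (z - 1))).

Definition taylor_coef (f : R -> R) (k : nat) : R := derive1n k f 0 / k`!%:R.

(* The identity of power series is stated coefficientwise.  The sum over la
   is a sum of finite support: the lowest-degree component of
   [grothendieck la] has degree |la|, so only the la with |la| <= |m|
   contribute to the coefficient of z^m. *)
Definition M_family (A B : seq R) (M : forall n, intpart n -> R) : Prop :=
  (forall la : intpart 0, M 0%N la = 1) /\
  (forall n (m : multinom n), (0 < n)%N ->
    \sum_(la \in [set: intpart n])
       (M n la * (mcoeff m (grothendieck la) / grothendieck1 la))
    = \prod_(i < n) taylor_coef (Phi A B) (m i)).

End Grothendieck.

(* Main.v *)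
Require Import Defs.
From mathcomp Require Import all_boot all_order all_algebra perm.
From mathcomp Require Import all_classical all_reals all_analysis.
From mathcomp Require Import ring lra zify.
From mathcomp Require Import -(notations) mpoly.

(** Write G_la(x) for the value of the polynomial at x in [0,1]^n. Everything is
read off the normalized generating function
F_n(x) = sum_la M_n(la) G_la(x) / G_la(1^n), and the proof never uses formal
power series: positivity makes all sums absolutely convergent on the cube.

Positivity. Splitting off the last variable (lemma branching) expands G_la
into a sum, over interlacing chains, of products of x_i^{a_i} (1 - p x_i)^{b_i}
with total a-degree |la| (lemma tableaux). Hence G_la is nonnegative on the cube
and positive at 1^n, G_la(x) / G_la(1^n) is at most a constant times s^{|la|} on [0,s]^n, and b_i is
at most K when la has at most K rows or at most K columns.

Uniqueness. Because of the factor s^{|la|}, the partitions of size at most K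
determine F_n on [0,s]^n up to O(s^{K+1}); comparing with the Taylor polynomial of the
right-hand side gives the coefficient identity (cube_gf_coeffs). Since G_la
has lowest-degree part s_la, that identity is triangular in la, so it determines
M_n (coeff_identity_uniq, cube_gf_uniq). Coherence follows: the projection of
M_{n+1} to level n has generating function F_{n+1}(x,1), which is the one of
M_n (cube_gf_coherent).

Existence. Multiplying G_la by the product of the factors of Phi over the
variables is a Pieri rule with nonnegative coefficients, obtained by column
operations in the defining determinant: row_pieri for a factor with parameter
alpha, column_pieri for a factor with parameter beta. Each alpha adds at most
one row and each beta at most one column. The rules are proved where the
Vandermonde determinant does not vanish, and expands_cube extends the resulting
identity to the whole cube, in particular to 1^n.

Extremality. Let M be the constructed system and t M1 <= M. Fix x in [0,1]^k
and put psi = prod Phi(x_i). Given la at level N = r k, the expansion over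
chains makes e(la) = G_la(x, 1, ...) / G_la(1^N) the mean of Y_s under a
probability measure, Y_s being the contribution of the s-th block of k
consecutive levels. By symmetry of G_la all the Y_s have mean e(la), and all
products of two distinct ones have mean e2(la) = G_la(x, x, 1, ...) / G_la(1^N).
The variance of the average of Y_1, ..., Y_r is nonnegative and the Y_s are
bounded: the partitions charged by M_N have at most K rows (at most K columns
in the beta case) with K independent of N. So e^2 <= e2 + O(1/r) (second_moment). Under M_N the mean of e is psi and, by
multiplicativity, that of e2 is psi^2. Thus e tends to psi in L^2(M_N), hence
in L^2(M1_N); as the mean of e under M1_N is the generating function of M1 at x
for every such N, it equals psi (component_gf), and M1 = M by uniqueness. *)

Set Implicit Arguments.
Unset Strict Implicit.
Unset Printing Implicit Defensive.

Import Order.TTheory GRing.Theory Num.Theory.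
Local Open Scope classical_set_scope.
Local Open Scope ring_scope.

(** * Sums of nonnegative families *)

Section HasSum.
Variable R : realType.
Implicit Types T U : choiceType.

(** The value is a real number, so that identities between sums can be handled by
[ring] and [lra] once convergence is known. *)
Definition has_sum T (f : T -> R) (l : R) : Prop :=
  (forall x, 0 <= f x) /\ (\esum_(x in [set: T]) (f x)%:E = l%:E)%E.

Lemma sumEFin_seq T (f : T -> R) (s : seq T) : uniq s ->
  (\sum_(x \in [set` s]) (f x)%:E = (\sum_(x <- s) f x)%:E)%E.
Proof. by move=> us; rewrite -(fsbig_seq _ _ us) sumEFin. Qed.

Lemma finite_uniqP T (A : set T) : finite_set A ->
  exists2 s : seq T, uniq s & A = [set` s].
Proof.
move=> /finite_seqP[s ->]; exists (undup s); first exact: undup_uniq.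
by apply/seteqP; split=> x /=; rewrite mem_undup.
Qed.

Lemma has_sum_ub T (f : T -> R) l (s : seq T) :
  has_sum f l -> uniq s -> \sum_(x <- s) f x <= l.
Proof.
move=> [f0 fl] us; rewrite -lee_fin -fl -(sumEFin_seq _ us).
by apply: ereal_sup_ubound; exists [set` s] => //; split.
Qed.

Lemma has_sum_ge0 T (f : T -> R) l : has_sum f l -> 0 <= l.
Proof. by move=> /has_sum_ub/(_ (isT : uniq [::])); rewrite big_nil. Qed.

Lemma has_sum_approx T (f : T -> R) l e :
  has_sum f l -> 0 < e -> exists2 s : seq T, uniq s & l - e < \sum_(x <- s) f x.
Proof.
move=> [f0 fl] e0.
have : ((l - e)%:E < \esum_(x in [set: T]) (f x)%:E)%E.
  by rewrite fl lte_fin ltrBlDr ltrDl.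
move=> /ereal_sup_gt[_ [A [/finite_uniqP[s us ->] _] <-]].
by rewrite sumEFin_seq // lte_fin; exists s.
Qed.

Lemma has_sum_intro T (f : T -> R) l : (forall x, 0 <= f x) ->
  (forall s, uniq s -> \sum_(x <- s) f x <= l) ->
  (forall e, 0 < e -> exists2 s : seq T, uniq s & l - e <= \sum_(x <- s) f x) ->
  has_sum f l.
Proof.
move=> f0 fub flb; split=> //; apply/eqP; rewrite eq_le; apply/andP; split.
  apply: ge_ereal_sup => _ [A [/finite_uniqP[s us ->] _] <-].
  by rewrite sumEFin_seq // lee_fin; exact: fub.
apply/lee_addgt0Pr => e e0; have [s us ls] := flb e e0.
rewrite -leeBlDr //; apply: (@le_trans _ _ (\sum_(x <- s) f x)%:E).
  by rewrite -EFinB lee_fin.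
rewrite -sumEFin_seq //.
by apply: ereal_sup_ubound; exists [set` s] => //; split.
Qed.

Lemma has_sum_bounded T (f : T -> R) B : (forall x, 0 <= f x) ->
  (forall s, uniq s -> \sum_(x <- s) f x <= B) ->
  exists2 l, has_sum f l & l <= B.
Proof.
move=> f0 fB.
have leB : (\esum_(x in [set: T]) (f x)%:E <= B%:E)%E.
  apply: ge_ereal_sup => _ [A [/finite_uniqP[s us ->] _] <-].
  by rewrite sumEFin_seq // lee_fin; exact: fB.
have ge0 : (0 <= \esum_(x in [set: T]) (f x)%:E)%E.
  by apply: esum_ge0 => x _; rewrite lee_fin.
have fin : (\esum_(x in [set: T]) (f x)%:E)%E \is a fin_num.
  by rewrite ge0_fin_numE // (le_lt_trans leB) ?ltry.
exists (fine (\esum_(x in [set: T]) (f x)%:E)%E).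
  by split=> //; rewrite fineK.
by rewrite -lee_fin fineK.
Qed.

Lemma has_sum_uniq T (f : T -> R) l l' : has_sum f l -> has_sum f l' -> l = l'.
Proof. by move=> [_ fl] [_]; rewrite fl => -[]. Qed.

Lemma eq_has_sum T (f g : T -> R) l : f =1 g -> has_sum f l -> has_sum g l.
Proof. by move=> /funext->. Qed.

Lemma has_sum_le T (f g : T -> R) l m : (forall x, f x <= g x) ->
  has_sum f l -> has_sum g m -> l <= m.
Proof.
move=> fg [_ fl] [_ gm]; rewrite -lee_fin -fl -gm.
by apply: le_esum => x _; rewrite lee_fin.
Qed.

Lemma has_sum_dom T (f g : T -> R) m : (forall x, 0 <= f x <= g x) ->
  has_sum g m -> exists2 l, has_sum f l & l <= m.
Proof.
move=> fg gm; apply: has_sum_bounded => [x|s us]; first by case/andP: (fg x).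
apply: le_trans (has_sum_ub gm us); apply: ler_sum => x _.
by case/andP: (fg x).
Qed.

Lemma has_sumD T (f g : T -> R) l m :
  has_sum f l -> has_sum g m -> has_sum (fun x => f x + g x) (l + m).
Proof.
move=> [f0 fl] [g0 gm]; split=> [x|]; first exact: addr_ge0.
under eq_esum => x _ do rewrite EFinD.
rewrite esumD ?fl ?gm // => x _; rewrite lee_fin //.
Qed.

Lemma has_sumZ T (f : T -> R) l c : 0 <= c ->
  has_sum f l -> has_sum (fun x => c * f x) (c * l).
Proof.
move=> c0 fl; have f0 x := fl.1 x.
apply: has_sum_intro => [x|s us|e e0]; first exact: mulr_ge0.
  by rewrite -mulr_sumr ler_wpM2l // (has_sum_ub fl us).
have [->|cn0] := eqVneq c 0.
  by exists [::] => //; rewrite big_nil mul0r sub0r oppr_le0 ltW.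
have cp : 0 < c by rewrite lt_def cn0.
have [s us /ltW ls] := has_sum_approx fl (divr_gt0 e0 cp).
exists s => //; rewrite -mulr_sumr; apply: le_trans (ler_wpM2l c0 ls).
by rewrite mulrBr mulrCA mulfV // mulr1.
Qed.

Lemma has_sum_seq T (f : T -> R) (s : seq T) : uniq s ->
  (forall x, 0 <= f x) -> (forall x, x \notin s -> f x = 0) ->
  has_sum f (\sum_(x <- s) f x).
Proof.
move=> us f0 fs; apply: has_sum_intro => // [r ur|e e0]; last first.
  by exists s => //; rewrite lerBlDr lerDl ltW.
rewrite (bigID (mem s)) /= addrC big1 // add0r.
rewrite -big_filter.
have : {subset [seq i <- r | i \in s] <= s}.
  by move=> x; rewrite mem_filter => /andP[].
move: (filter_uniq (mem s) ur); move: [seq _ <- _ | _] => q uq qs.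
rewrite [leRHS](perm_big (q ++ [seq x <- s | x \notin q])) /=; last first.
  apply: uniq_perm => //.
    rewrite cat_uniq uq filter_uniq // andbT /=; apply/hasPn => x.
    by rewrite mem_filter => /andP[].
  move=> x; rewrite mem_cat mem_filter; have := qs x.
  by case: (x \in q) => [/(_ isT) ->|_].
by rewrite big_cat /= lerDl sumr_ge0.
Qed.

(** Nonnegativity allows the exchange, and it bounds each new sum by the total. *)
Lemma has_sum_fubini T U (a : T -> U -> R) (b : T -> R) l :
  (forall i, has_sum (a i) (b i)) -> has_sum b l ->
  exists2 c : U -> R, (forall j, has_sum (fun i => a i j) (c j)) & has_sum c l.
Proof.
move=> ab bl.
have a0 i j : 0 <= a i j by exact: (ab i).1.
have swap : (\esum_(j in [set: U]) \esum_(i in [set: T]) (a i j)%:E = l%:E)%E.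
  rewrite -bl.2; under [RHS]eq_esum => i _ do rewrite -(ab i).2.
  rewrite !esum_esum; try by move=> *; rewrite lee_fin.
  rewrite (reindex_esum [set: T * U] _ (fun x : T * U => (x.2, x.1))) //=.
  - have -> : [set: T] `*`` (fun=> [set: U]) = [set: T * U] by apply/seteqP; split.
    by apply: eq_esum.
  - split=> // [[x1 x2] [y1 y2] _ _ [-> ->] //|[x1 x2] _].
    by exists (x2, x1).
have ge0 j : (0 <= \esum_(i in [set: T]) (a i j)%:E)%E.
  by apply: esum_ge0 => i _; rewrite lee_fin.
have fin j : (\esum_(i in [set: T]) (a i j)%:E)%E \is a fin_num.
  rewrite ge0_fin_numE //; apply: le_lt_trans (ltry l); rewrite -swap.
  rewrite -[leLHS](@esum_set1 R U j (fun k => \esum_(i in [set: T]) (a i k)%:E)%E) //.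
  by rewrite esum_mkcond; apply: le_esum => k _; case: ifP.
exists (fun j => fine (\esum_(i in [set: T]) (a i j)%:E)%E).
  by move=> j; split=> //; rewrite fineK.
split=> [j|]; first exact: fine_ge0.
by under eq_esum => j _ do rewrite fineK //.
Qed.
End HasSum.

(** * Partitions *)

Section Parts.
Implicit Type n : nat.

Lemma part_out n (la : intpart n) i : (n <= i)%N -> part la i = 0%N.
Proof. by move=> ni; rewrite /part nth_default // size_tuple. Qed.

Lemma part_sorted n (la : intpart n) i j :
  (i <= j)%N -> (part la j <= part la i)%N.
Proof.
move=> ij; have [jn|nj] := ltnP j n; last by rewrite part_out.
case: la => t st; rewrite /part /=.
have gt : transitive geq by move=> a b c ba ac; exact: leq_trans ac ba.
have gr : reflexive geq by move=> a; exact: leqnn.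
by apply: (sorted_leq_nth gt gr 0%N st); rewrite ?inE ?size_tuple // (leq_ltn_trans ij).
Qed.

Lemma eq_intpart n (la mu : intpart n) :
  (forall i : 'I_n, part la i = part mu i) -> la = mu.
Proof.
move=> e; apply/val_inj/eq_from_tnth => i.
by have := e i; rewrite /part !(tnth_nth 0%N).
Qed.

Lemma intpart_of_fun n (f : nat -> nat) :
  (forall i, (i.+1 < n)%N -> (f i.+1 <= f i)%N) ->
  {la : intpart n | forall i : 'I_n, part la i = f i}.
Proof.
move=> fle.
have s : sorted geq [tuple f i | i < n].
  apply/(sortedP 0%N) => i; rewrite size_tuple => lt.
  rewrite /= !(nth_map (Ordinal lt)) -?enumT ?size_enum_ord ?(ltnW lt) //.
  by rewrite !nth_enum_ord ?(ltnW lt) //; apply: fle.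
exists (IntPart s) => i; rewrite /part /=.
by rewrite (nth_map i) ?size_enum_ord // nth_ord_enum.
Qed.

Definition psize n (la : intpart n) : nat := \sum_(i < n) part la i.

Lemma part_le_psize n (la : intpart n) i : (part la i <= psize la)%N.
Proof.
have [ni|ni] := ltnP i n; last by rewrite part_out.
by rewrite /psize (bigD1 (Ordinal ni)) //= leq_addr.
Qed.

(** A finite exhaustion of the partitions by their largest part. *)
Definition parts n B : seq (intpart n) :=
  pmap insub [seq map_tuple val t | t : n.-tuple 'I_B].

Lemma parts_uniq n B : uniq (parts n B).
Proof.
apply: pmap_sub_uniq; rewrite map_inj_uniq ?enum_uniq // => t u e.
apply/eq_from_tnth => i; apply/val_inj.
by have := congr1 (fun v => tnth v i) e; rewrite !tnth_map.
Qed.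

Lemma mem_parts n B (la : intpart n) :
  (la \in parts n B) = [forall i : 'I_n, part la i < B]%N.
Proof.
rewrite mem_pmap_sub; apply/mapP/forallP => [[t _ e] i|lt].
  have -> : part la i = tnth (val la) i by rewrite (tnth_nth 0%N).
  by rewrite e tnth_map; exact: (ltn_ord (tnth t i)).
exists [tuple Ordinal (lt i) | i < n]; first by rewrite mem_enum.
apply/eq_from_tnth => i; rewrite tnth_map tnth_mktuple /=.
by rewrite (tnth_nth 0%N).
Qed.

Lemma mem_parts_le n B (la : intpart n) : (part la 0 < B)%N -> la \in parts n B.
Proof.
by move=> lt; rewrite mem_parts; apply/forallP => i; exact: leq_ltn_trans (part_sorted _ _) lt.
Qed.

End Parts.

(** * Evaluation of Grothendieck polynomials on the cube *)

Section Eval.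
Variables (R : realType) (p : R).
Implicit Types n : nat.

Definition alternant n (x : 'I_n -> R) (e : nat -> nat) : R :=
  \det (\matrix_(i, j < n) (x i ^+ (e j + (n - j.+1)) * (1 - p * x i) ^+ j)).

Definition vandermonde n (x : 'I_n -> R) : R :=
  \det (\matrix_(i, j < n) x i ^+ (n - j.+1)).

Definition geval n (la : intpart n) (x : 'I_n -> R) : R :=
  meval x (grothendieck p la).

(** The form in which the definition is used: at a real point, the alternant is
the Vandermonde determinant times the value. *)
Lemma vandermonde_geval n (la : intpart n) x : vandermonde x * geval la x = alternant x (part la).
Proof.
have <- : meval x (vandermonde_den R n) = vandermonde x.
  rewrite -det_map_mx; congr (\det _); apply/matrixP => i j.
  by rewrite !mxE rmorphXn /= mevalXU.
rewrite mulrC -mevalM -grothendieckP.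
rewrite -det_map_mx; congr (\det _); apply/matrixP => i j.
by rewrite !mxE rmorphM !rmorphXn rmorphB rmorph1 /= mevalZ !mevalXU.
Qed.

Lemma vandermonde_neq0 n (x : 'I_n -> R) : injective x -> vandermonde x != 0.
Proof.
move=> xi; rewrite /vandermonde.
have -> : \matrix_(i, j < n) x i ^+ (n - j.+1)
          = col_perm (perm rev_ord_inj) (Vandermonde n (\row_(i < n) x i))^T.
  by apply/matrixP => i j; rewrite !mxE permE.
rewrite col_permE det_mulmx det_perm mulf_neq0 ?signr_eq0 //.
rewrite det_tr det_Vandermonde; apply/prodf_neq0 => i _.
apply/prodf_neq0 => j ij; rewrite !mxE subr_eq0.
by apply: contraTneq ij => /xi ->; rewrite ltnn.
Qed.

Definition segment n (x y : 'I_n -> R) (e : R) : 'I_n -> R :=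
  fun i => x i + e * (y i - x i).

(** Restriction to lines reduces density and continuity arguments in the cube to
univariate polynomials. *)
Definition line_poly n (F : ('I_n -> R) -> R) : Prop :=
  forall x y, exists q : {poly R}, forall e, F (segment x y e) = q.[e].

Lemma line_poly_cst n c : line_poly (fun _ : 'I_n -> R => c).
Proof. by move=> x y; exists c%:P => e; rewrite hornerC. Qed.

Lemma line_poly_var n i : line_poly (fun x : 'I_n -> R => x i).
Proof.
by move=> x y; exists ((x i)%:P + 'X * (y i - x i)%:P) => e; rewrite !hornerE.
Qed.

Lemma line_polyD n (F G : ('I_n -> R) -> R) :
  line_poly F -> line_poly G -> line_poly (fun x => F x + G x).
Proof.
move=> hF hG x y; have [q qE] := hF x y; have [r rE] := hG x y.
by exists (q + r) => e; rewrite hornerD qE rE.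
Qed.

Lemma line_polyM n (F G : ('I_n -> R) -> R) :
  line_poly F -> line_poly G -> line_poly (fun x => F x * G x).
Proof.
move=> hF hG x y; have [q qE] := hF x y; have [r rE] := hG x y.
by exists (q * r) => e; rewrite hornerM qE rE.
Qed.

Lemma line_polyX n (F : ('I_n -> R) -> R) k :
  line_poly F -> line_poly (fun x => F x ^+ k).
Proof.
move=> hF x y; have [q qE] := hF x y.
by exists (q ^+ k) => e; rewrite horner_exp qE.
Qed.

Lemma line_poly_sum n I (r : seq I) (P : pred I) (F : I -> ('I_n -> R) -> R) :
  (forall i, line_poly (F i)) -> line_poly (fun x => \sum_(i <- r | P i) F i x).
Proof.
move=> hF x y; have q i := cid (hF i x y).
exists (\sum_(i <- r | P i) sval (q i)) => e; rewrite horner_sum.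
by apply: eq_bigr => i _; rewrite (svalP (q i)).
Qed.

Lemma line_poly_prod n I (r : seq I) (P : pred I) (F : I -> ('I_n -> R) -> R) :
  (forall i, line_poly (F i)) -> line_poly (fun x => \prod_(i <- r | P i) F i x).
Proof.
move=> hF x y; have q i := cid (hF i x y).
exists (\prod_(i <- r | P i) sval (q i)) => e; rewrite horner_prod.
by apply: eq_bigr => i _; rewrite (svalP (q i)).
Qed.

Lemma line_poly_comp n m (F : ('I_m -> R) -> R) (h : ('I_n -> R) -> 'I_m -> R) :
  (forall x y e i, h (segment x y e) i = segment (h x) (h y) e i) ->
  line_poly F -> line_poly (fun x => F (h x)).
Proof.
move=> hE hF x y; have [q qE] := hF (h x) (h y); exists q => e.
by rewrite -qE; congr F; apply/funext => i; exact: hE.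
Qed.

Lemma line_poly_meval n (P : mpoly n R) : line_poly (fun x => meval x P).
Proof.
have -> : (fun x => meval x P) =
    (fun x => \sum_(m <- msupp P) mcoeff m P * \prod_i x i ^+ m i).
  by apply/funext => x; rewrite mevalE.
apply: line_poly_sum => m; apply: line_polyM; first exact: line_poly_cst.
by apply: line_poly_prod => i; apply/line_polyX/line_poly_var.
Qed.

Lemma line_poly_vandermonde n : line_poly (@vandermonde n).
Proof.
apply: line_poly_sum => s; apply: line_polyM; first exact: line_poly_cst.
apply: line_poly_prod => i.
have -> : (fun x : 'I_n -> R => (\matrix_(i, j < n) x i ^+ (n - j.+1)) i (s i)) =
   (fun x => x i ^+ (n - (s i).+1)) by apply/funext => x; rewrite mxE.
exact/line_polyX/line_poly_var.
Qed.

(** A point of the cube with distinct coordinates; segments towards it leave the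
zero set of the Vandermonde determinant at once. *)
Definition grid n (i : 'I_n) : R := i.+1%:R / n.+1%:R.

Lemma grid_itv n (i : 'I_n) : 0 <= grid i <= 1.
Proof.
by rewrite /grid divr_ge0 //= ler_pdivrMr // mul1r ler_nat ltnW // ltnS.
Qed.

Lemma vandermonde_grid n : vandermonde (@grid n) != 0.
Proof.
apply: vandermonde_neq0 => i j /(mulIf (_ : _ != 0)); rewrite invr_eq0 pnatr_eq0 => /(_ isT).
by move/eqP; rewrite eqr_nat eqSS => /eqP/val_inj.
Qed.

Lemma poly0_itv (q : {poly R}) : (forall e, 0 < e < 1 -> q.[e] = 0) -> q = 0.
Proof.
move=> q0; apply: (@roots_geq_poly_eq0 _ q [seq (k.+2%:R)^-1 | k <- iota 0 (size q)]).
- apply/allP => _ /mapP[k _ ->]; apply/rootP/q0.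
  by rewrite invr_gt0 ltr0n /= invf_lt1 ?ltr0n // ltr1n.
- rewrite map_inj_uniq ?iota_uniq // => k l /invr_inj/eqP.
  by rewrite eqr_nat => /eqP[].
- by rewrite size_map size_iota.
Qed.

(** On a segment from x to the grid point both functions and the Vandermonde
determinant are polynomials in the parameter, and the last one is not zero; so
the difference of the first two is the zero polynomial. *)
Lemma cube_density n (F G : ('I_n -> R) -> R) :
  line_poly F -> line_poly G ->
  (forall x, (forall i, 0 <= x i <= 1) -> vandermonde x != 0 -> F x = G x) ->
  forall x, (forall i, 0 <= x i <= 1) -> F x = G x.
Proof.
move=> hF hG FG x x01.
have [q qE] := hF x (@grid n); have [r rE] := hG x (@grid n).
have [w wE] := line_poly_vandermonde x (@grid n).
have seg0 (H : ('I_n -> R) -> R) : H x = H (segment x (@grid n) 0).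
  by congr H; apply/funext => i; rewrite /segment mul0r addr0.
have w0 : w != 0.
  apply: contraNneq (vandermonde_grid n) => w0.
  have := wE 1; rewrite w0 horner0 => e1; apply/eqP; rewrite -[RHS]e1; congr (vandermonde _); apply/funext => i.
  by rewrite /segment mul1r addrC subrK.
suff qr : q - r = 0.
  by rewrite seg0 [RHS]seg0 qE rE; apply/eqP; rewrite -subr_eq0 -hornerN -hornerD qr horner0.
suff /eqP : (q - r) * w = 0 by rewrite mulf_eq0 (negPf w0) orbF => /eqP.
apply: poly0_itv => e /andP[e0 e1]; rewrite hornerM -wE hornerD hornerN -qE -rE.
have [->|vn0] := eqVneq (vandermonde (segment x (@grid n) e)) 0; first by rewrite mulr0.
rewrite FG ?subrr ?mul0r // => i; have := x01 i; have := grid_itv i.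
by rewrite /segment; nra.
Qed.

End Eval.

(** * The branching rule *)

Section Expand.
Variables (R : realType) (p : R).

(** Multilinearity in all columns at once. *)
Lemma det_sum_cols n (I : finType) (M : 'I_n -> 'I_n -> I -> R) :
  \det (\matrix_(i, j) \sum_r M i j r) =
  \sum_(m : {ffun 'I_n -> I}) \det (\matrix_(i, j) M i j (m j)).
Proof.
rewrite -det_tr.
under [RHS]eq_bigr => m _ do rewrite -det_tr.
rewrite /determinant exchange_big; apply: eq_bigr => s _ /=.
rewrite -big_distrr /=; congr (_ * _).
under eq_bigr => i _ do rewrite !mxE.
rewrite bigA_distr_bigA; apply: eq_bigr => m _.
by apply: eq_bigr => i _; rewrite !mxE.
Qed.

(** The weights force the exponents that occur to form a partition, so that the
multilinear expansion is a sum over partitions. *)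
Lemma alternant_expand n B (x : 'I_n -> R) (k : nat -> nat -> R) :
  (forall j a b, (j.+1 < n)%N -> k j a != 0 -> k j.+1 b != 0 -> (b <= a)%N) ->
  \det (\matrix_(i, j < n) \sum_(r < B)
     k j r * (x i ^+ (r + (n - j.+1)) * (1 - p * x i) ^+ j)) =
  \sum_(mu <- parts n B) (\prod_(j < n) k j (part mu j)) * alternant p x (part mu).
Proof.
move=> kmono; rewrite det_sum_cols.
rewrite big_pmap big_map big_enum /=.
pose h (m : {ffun 'I_n -> 'I_B}) := [tuple m i | i < n].
have hb : bijective h.
  exists (fun t => [ffun i => tnth t i]) => [m|t]; first by apply/ffunP => i; rewrite ffunE tnth_mktuple.
  by apply/eq_from_tnth => i; rewrite tnth_mktuple ffunE.
rewrite [RHS](reindex h) /=; last exact: onW_bij.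
apply: eq_bigr => m _.
have -> : \det (\matrix_(i, j < n)
     (k j (m j) * (x i ^+ (m j + (n - j.+1)) * (1 - p * x i) ^+ j))) =
   (\prod_(j < n) k j (m j)) *
   \det (\matrix_(i, j < n) (x i ^+ (m j + (n - j.+1)) * (1 - p * x i) ^+ j)).
  pose D := diag_mx (\row_(j < n) k j (m j)).
  have -> : \prod_(j < n) k j (m j) = \det D.
    by rewrite det_diag; apply: eq_bigr => j _; rewrite mxE.
  rewrite mulrC -det_mulmx; congr (\det _); apply/matrixP => i j.
  by rewrite mul_mx_diag !mxE mulrC.
case: insubP => [mu _ muE|ns].
  have partE (j : 'I_n) : part mu j = m j.
    have -> : part mu j = tnth (val mu) j by rewrite (tnth_nth 0%N).
    by rewrite muE tnth_map tnth_mktuple.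
  congr (_ * _); first by apply: eq_bigr => j _; rewrite partE.
  by congr (\det _); apply/matrixP => i j; rewrite !mxE partE.
suff -> : \prod_(j < n) k j (m j) = 0 by rewrite mul0r.
apply/eqP; apply: contraNT ns => /prodf_neq0 k0; apply/(sortedP 0%N) => i.
rewrite size_tuple => lt.
have lt' := ltnW lt.
have nthE j (jn : (j < n)%N) : nth 0%N (map_tuple val (h m)) j = m (Ordinal jn).
  have -> : nth 0%N (map_tuple val (h m)) j = tnth (map_tuple val (h m)) (Ordinal jn).
    by rewrite (tnth_nth 0%N).
  by rewrite tnth_map tnth_mktuple.
rewrite !nthE; apply: (kmono i) => //; [exact: (k0 (Ordinal lt'))|exact: (k0 (Ordinal lt))].
Qed.

Lemma sum_window B m M (G : nat -> R) : (m <= M)%N -> (M < B)%N ->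
  \sum_(k < B) (if (m <= k <= M)%N then G k else 0) =
  \sum_(r < (M - m).+1) G (m + r)%N.
Proof.
move=> mM MB; rewrite -big_mkcond /= -subSn // -(big_mkord xpredT (fun r => G (m + r)%N)).
under [RHS]eq_bigr => r _ do rewrite addnC.
rewrite -(big_addn 0 M.+1 m xpredT G) big_geq_mkord.
rewrite (big_ord_widen_cond B (fun k => m <= k)%N G) //=.
Qed.

(** The operations are a product with a lower bidiagonal matrix. *)
Lemma det_colop_next n (F : 'I_n -> nat -> R) (a b : nat -> R) :
  \det (\matrix_(i, j < n)
     (a j * F i j - (if (j.+1 < n)%N then b j * F i j.+1 else 0))) =
  (\prod_(j < n) a j) * \det (\matrix_(i, j < n) F i j).
Proof.
pose T : 'M[R]_n := \matrix_(k, j) (if k == j then a j else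
                                     if val k == j.+1 then - b j else 0).
have -> : \prod_(j < n) a j = \det T.
  rewrite det_trig; first by apply: eq_bigr => j _; rewrite mxE eqxx.
  apply/is_trig_mxP => i j ij; rewrite mxE -val_eqE /= (ltn_eqF ij).
  by rewrite (ltn_eqF (leq_trans ij _)).
rewrite mulrC -det_mulmx; congr (\det _); apply/matrixP => i j; rewrite !mxE.
rewrite (bigD1 j) //= !mxE eqxx mulrC; congr (_ + _).
under eq_bigr => k /negPf kj do rewrite !mxE kj.
case: ltnP => jn; last first.
  rewrite oppr0 big1 // => k _; case: eqP => [kj|_]; last by rewrite mulr0.
  by have := ltn_ord k; rewrite kj ltnNge jn.
rewrite (bigD1 (Ordinal jn)) /=; last by rewrite -val_eqE /= gtn_eqF.
rewrite eqxx big1 ?addr0; first by rewrite mulrN mulrC.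
move=> k /andP[_ /negPf kn]; case: eqP => [kj|_]; last by rewrite mulr0.
by move: kn; rewrite -val_eqE /= kj eqxx.
Qed.

(** The operations are a product with an upper unitriangular bidiagonal matrix. *)
Lemma det_colop_prev n (F : 'I_n -> nat -> R) (b : nat -> R) :
  \det (\matrix_(i, j < n)
     (F i j - (if (0 < j)%N then b j * F i j.-1 else 0))) =
  \det (\matrix_(i, j < n) F i j).
Proof.
pose T : 'M[R]_n := \matrix_(j, k) (if k == j then 1 else
                                     if val j == k.+1 then - b j else 0).
have T1 : \det T = 1.
  rewrite det_trig; first by rewrite big1 // => j _; rewrite mxE eqxx.
  apply/is_trig_mxP => i j ij; rewrite mxE -val_eqE /= (gtn_eqF ij).
  by rewrite (ltn_eqF (leq_trans ij _)).
rewrite -[RHS]mulr1 -T1 -[\det T]det_tr -det_mulmx.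
congr (\det _); apply/matrixP => i j; rewrite !mxE.
rewrite (bigD1 j) //= !mxE eqxx mulr1; congr (_ + _).
under eq_bigr => k /negPf kj do rewrite !mxE kj.
case: posnP => [j0|jp].
  by rewrite oppr0 big1 // => k _; rewrite /= j0 /= mulr0.
have jn : (j.-1 < n)%N by rewrite (leq_ltn_trans (leq_pred _)).
rewrite (bigD1 (Ordinal jn)) /=; last by rewrite -val_eqE /= ltn_eqF // prednK.
rewrite prednK // eqxx big1 ?addr0; first by rewrite mulrN mulrC.
move=> k /andP[_ /negPf kn]; case: eqP => [kj|_]; last by rewrite mulr0.
by move: kn; rewrite -val_eqE /= kj eqxx.
Qed.

(** After division by z - y, the combination of two neighbouring columns that
vanishes at z = y has nonnegative coefficients
y^(d-r) (1 - p y)^[r > 0]. *)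
Lemma branching_core (y z : R) d :
  (1 - p * y) * z ^+ d.+1 - y ^+ d.+1 * (1 - p * z) =
  (z - y) * \sum_(r < d.+1) y ^+ (d - r) * (1 - p * y) ^+ (0 < r)%N * z ^+ r.
Proof.
elim: d => [|d IH]; first by rewrite big_ord1 /= !expr0 !expr1; ring.
rewrite big_ord_recr /= subnn expr0 expr1 mul1r.
set S := \sum_(r < d.+1) _ in IH; set S' := \sum_(i < d.+1) _.
have -> : S' = y * S.
  rewrite /S big_distrr /=; apply: eq_bigr => r _.
  by rewrite subSn ?leq_ord // exprS -!mulrA.
transitivity (y * ((z - y) * S) + (z - y) * ((1 - p * y) * z ^+ d.+1)); last ring.
rewrite -IH !(exprS _ d.+1); ring.
Qed.

(** Contribution of one part to the branching weight; it vanishes unless k lies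
between the neighbouring parts of the larger partition. *)
Definition branch_weight n (la : intpart n.+1) (y : R) (j k : nat) : R :=
  if (part la j.+1 <= k <= part la j)%N
  then y ^+ (part la j - k) * (1 - p * y) ^+ (part la j.+1 < k)%N else 0.

Lemma branching_col n (la : intpart n.+1) (y z : R) j B : (j < n)%N ->
  (part la 0 < B)%N ->
  (1 - p * y) * (z ^+ (part la j + (n.+1 - j.+1)) * (1 - p * z) ^+ j) -
  y ^+ (part la j - part la j.+1).+1 *
     (z ^+ (part la j.+1 + (n.+1 - j.+2)) * (1 - p * z) ^+ j.+1) =
  (z - y) * \sum_(k < B)
     branch_weight la y j k * (z ^+ (k + (n - j.+1)) * (1 - p * z) ^+ j).
Proof.
move=> jn laB.
have le : (part la j.+1 <= part la j)%N by exact: part_sorted.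
have ltB : (part la j < B)%N by exact: leq_ltn_trans (part_sorted _ _) laB.
rewrite /branch_weight.
under eq_bigr => k _ do rewrite (fun_if (fun w => w * _)) mul0r.
rewrite (sum_window (fun k => y ^+ (part la j - k) *
   (1 - p * y) ^+ (part la j.+1 < k)%N * (z ^+ (k + (n - j.+1)) * (1 - p * z) ^+ j)) le ltB).
set m := part la j.+1 in le *; set d := (part la j - m)%N.
have -> : part la j = (m + d)%N by rewrite subnKC.
rewrite !subSS.
have -> : (m + d + (n - j) = d.+1 + (m + (n - j.+1)))%N.
  by rewrite -[(n - j)%N]prednK ?subn_gt0 // -subnS; lia.
set u := z ^+ (m + (n - j.+1)).
transitivity (((1 - p * y) * z ^+ d.+1 - y ^+ d.+1 * (1 - p * z)) *
  (u * (1 - p * z) ^+ j)).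
  by rewrite exprD exprS; rewrite [(1 - p * z) ^+ j.+1]exprS /u; ring.
rewrite branching_core -mulrA; congr (_ * _); rewrite big_distrl /=.
apply: eq_bigr => r _.
have -> : (m + d - (m + r) = d - r)%N by rewrite subnDl.
have -> : (m < m + r)%N = (0 < r)%N by rewrite -{1}[m]addn0 ltn_add2l.
by rewrite -addnA addnCA exprD /u; ring.
Qed.

Definition but_last n (x : 'I_n.+1 -> R) : 'I_n -> R := fun i => x (lift ord_max i).

Lemma det_last_row n (F : 'I_n.+1 -> nat -> R) :
  (forall j, (j < n)%N -> F ord_max j = 0) ->
  \det (\matrix_(i, j < n.+1) F i j) =
  F ord_max n * \det (\matrix_(i, j < n) F (lift ord_max i) j).
Proof.
move=> F0; rewrite (expand_det_row _ ord_max) big_ord_recr /= big1 ?add0r; last first.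
  by move=> j _; rewrite mxE /= F0 ?mul0r // ltn_ord.
rewrite mxE /cofactor addnn -signr_odd odd_double expr0 mul1r.
congr (_ * \det _); apply/matrixP => i j; rewrite !mxE.
by rewrite lift_max.
Qed.

Lemma vandermonde_recr n (x : 'I_n.+1 -> R) :
  vandermonde x = (\prod_(i < n) (but_last x i - x ord_max)) * vandermonde (but_last x).
Proof.
pose F (i : 'I_n.+1) j := x i ^+ (n.+1 - j.+1).
have <- : \det (\matrix_(i, j < n.+1) (1 * F i j -
    (if (j.+1 < n.+1)%N then x ord_max * F i j.+1 else 0))) = vandermonde x.
  by rewrite (det_colop_next F (fun=> 1) (fun=> x ord_max)) big1 ?mul1r.
rewrite (@det_last_row n (fun i j => 1 * F i j -
   (if (j.+1 < n.+1)%N then x ord_max * F i j.+1 else 0))); last first.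
  by move=> j jn; rewrite ltnS jn mul1r /F -exprS -subSn ?subrr.
rewrite /F mul1r /vandermonde.
rewrite ltnn subnn expr0 subr0 mul1r.
have -> : \prod_(i < n) (but_last x i - x ord_max) =
   \det (diag_mx (\row_(i < n) (but_last x i - x ord_max))).
  by rewrite det_diag; apply: eq_bigr => i _; rewrite mxE.
rewrite -det_mulmx; congr (\det _); apply/matrixP => i j.
rewrite mul_diag_mx !mxE mul1r ltnS ltn_ord subSS -[(n - j)%N]prednK ?subn_gt0 //.
by rewrite -subnS exprS mulrBl.
Qed.

(** The column operations of [branching_core] clear the last row except for its
last entry. They multiply the determinant by (1 - p y)^n, which cancels against
the same power in that entry. *)
Lemma alternant_recr n (la : intpart n.+1) B (x : 'I_n.+1 -> R) :
  (part la 0 < B)%N -> 1 - p * x ord_max != 0 ->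
  alternant p x (part la) = x ord_max ^+ part la n *
    (\prod_(i < n) (but_last x i - x ord_max)) *
    \sum_(mu <- parts n B)
      (\prod_(j < n) branch_weight la (x ord_max) j (part mu j)) *
        alternant p (but_last x) (part mu).
Proof.
set y := x ord_max => laB y1.
have cn0 : \prod_(j < n.+1) (if (j < n)%N then 1 - p * y else 1) = (1 - p * y) ^+ n.
  rewrite big_ord_recr /= ltnn mulr1.
  under eq_bigr => j _ do rewrite ltn_ord.
  by rewrite prodr_const card_ord.
(* the factor produced by scaling n columns by 1 - p y *)
apply: (mulfI (expf_neq0 n y1)).
pose F (i : 'I_n.+1) j := x i ^+ (part la j + (n.+1 - j.+1)) * (1 - p * x i) ^+ j.
pose a j := if (j < n)%N then 1 - p * y else 1.
pose b j := y ^+ (part la j - part la j.+1).+1.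
have -> : (1 - p * y) ^+ n * alternant p x (part la) = \det (\matrix_(i, j < n.+1)
    (a j * F i j - (if (j.+1 < n.+1)%N then b j * F i j.+1 else 0))).
  by rewrite (det_colop_next F a b) cn0.
rewrite (@det_last_row n (fun i j =>
   a j * F i j - (if (j.+1 < n.+1)%N then b j * F i j.+1 else 0))); last first.
  move=> j jn; rewrite ltnS jn /a jn /F /b (branching_col _ _ jn laB).
  by rewrite subrr mul0r.
rewrite /a /F /b.
rewrite -/y !ltnn subnn addn0 subr0 mul1r.
rewrite -!mulrA [RHS]mulrCA; congr (_ * _); congr (_ * _).
rewrite -(@alternant_expand n B (but_last x) (branch_weight la y)); last first.
  move=> j k l jn; rewrite /branch_weight.
  case: ifP => [/andP[ja _] _|]; last by rewrite eqxx.
  case: ifP => [/andP[_ jb] _|]; last by rewrite eqxx.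
  exact: leq_trans jb ja.
have -> : \prod_(i < n) (but_last x i - y) =
   \det (diag_mx (\row_(i < n) (but_last x i - y))).
  by rewrite det_diag; apply: eq_bigr => i _; rewrite mxE.
rewrite -det_mulmx; congr (\det _); apply/matrixP => i j.
rewrite mul_diag_mx !mxE ltnS ltn_ord (branching_col _ _ _ laB) //.
Qed.

Definition jumps n (mu : intpart n) (la : intpart n.+1) : nat :=
  #|[pred i : 'I_n | (part la i.+1 < part mu i)%N]|.

Lemma psize_recr n (la : intpart n.+1) :
  psize la = (\sum_(i < n) part la i + part la n)%N.
Proof. by rewrite /psize big_ord_recr. Qed.

Lemma interlaceP n (mu : intpart n) (la : intpart n.+1) :
  reflect (forall i : 'I_n, (part la i.+1 <= part mu i <= part la i)%N)
    (interlace mu la).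
Proof.
by apply: (iffP forallP) => h i; have := h i; rewrite andbC.
Qed.

Lemma interlace_size n (mu : intpart n) (la : intpart n.+1) :
  interlace mu la -> (psize mu <= psize la)%N.
Proof.
move=> /interlaceP h; rewrite psize_recr (leq_trans _ (leq_addr _ _)) //.
by apply: leq_sum => i _; case/andP: (h i).
Qed.

Lemma prod_branch_weight n (mu : intpart n) (la : intpart n.+1) y :
  y ^+ part la n * \prod_(j < n) branch_weight la y j (part mu j) =
  if interlace mu la
  then y ^+ (psize la - psize mu) * (1 - p * y) ^+ jumps mu la else 0.
Proof.
case: interlaceP => [h|h]; last first.
  have /existsP[i hi] : [exists i : 'I_n, ~~ (part la i.+1 <= part mu i <= part la i)%N].
    by rewrite -negb_forall; apply/negP => /forallP.
  by rewrite (bigD1 i) //= /branch_weight (negPf hi) mul0r mulr0.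
under eq_bigr => j _ do rewrite /branch_weight h.
rewrite big_split /= mulrA; congr (_ * _).
  rewrite -expr_sum -exprD; congr (_ ^+ _).
  rewrite psize_recr /psize sumnB; last by move=> i _; case/andP: (h i).
  rewrite addnC addnBAC // leq_sum // => i _; by case/andP: (h i).
rewrite -expr_sum /jumps -sum1_card [in RHS]big_mkcond /=.
by congr (_ ^+ _); apply: eq_bigr => j _; rewrite inE; case: ltnP.
Qed.

(** Where the Vandermonde determinant does not vanish, this is the quotient of
[alternant_recr] by [vandermonde_recr]; the rest of the cube follows by
density. *)
Lemma branching n (la : intpart n.+1) B (x : 'I_n.+1 -> R) :
  p < 1 -> 0 < p -> (part la 0 < B)%N -> (forall i, 0 <= x i <= 1) ->
  geval p la x = \sum_(mu <- parts n B | interlace mu la)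
    x ord_max ^+ (psize la - psize mu) * (1 - p * x ord_max) ^+ jumps mu la *
    geval p mu (but_last x).
Proof.
move=> p1 p0 laB; move: x; apply: cube_density.
- exact: line_poly_meval.
- apply: line_poly_sum => mu; apply: line_polyM; first apply: line_polyM.
  + exact/line_polyX/line_poly_var.
  + apply: line_polyX; apply: line_polyD; first exact: line_poly_cst.
    have -> : (fun x : 'I_n.+1 -> R => - (p * x ord_max)) =
      (fun x : 'I_n.+1 -> R => - p * x ord_max) by apply/funext => x; rewrite mulNr.
    by apply: line_polyM; [exact: line_poly_cst|exact: line_poly_var].
  + by apply: (line_poly_comp (h := @but_last n)); last exact: line_poly_meval.
move=> x x01 vx; apply: (mulfI vx).
have y1 : 1 - p * x ord_max != 0 by have := x01 ord_max; apply: contraTneq => ?; nra.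
rewrite vandermonde_geval (alternant_recr laB y1) vandermonde_recr.
rewrite [_ ^+ _ * _]mulrC -!mulrA; congr (_ * _).
rewrite !big_distrr /= [RHS]big_mkcond; apply: eq_bigr => mu _.
rewrite mulrA prod_branch_weight; case: ifP => _; last by rewrite mul0r.
by rewrite -vandermonde_geval mulrCA.
Qed.

End Expand.

(** * Expansion over interlacing chains *)

Section Tableaux.
Variables (R : realType) (p : R).
Hypotheses (p0 : 0 < p) (p1 : p < 1).

(** At most K rows or at most K columns. Both conditions pass to interlacing
partitions and bound the exponent of 1 - p x in a branching step. *)
Definition narrow K n (la : intpart n) : Prop :=
  part la K = 0%N \/ (part la 0 <= K)%N.

Lemma narrow_self n (la : intpart n) : narrow n la.
Proof. by left; exact: part_out. Qed.

Lemma interlace_part n (mu : intpart n) (la : intpart n.+1) i :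
  interlace mu la -> (part mu i <= part la i)%N.
Proof.
move=> /interlaceP h; have [ni|ni] := ltnP i n; last by rewrite part_out.
by case/andP: (h (Ordinal ni)).
Qed.

Lemma narrow_interlace K n (mu : intpart n) (la : intpart n.+1) :
  interlace mu la -> narrow K la -> narrow K mu.
Proof.
move=> h [l0|l0]; [left|right]; last exact: leq_trans (interlace_part _ h) l0.
by apply/eqP; rewrite -leqn0 -l0; exact: interlace_part.
Qed.

(** With at most K rows only the first K indices can jump. With at most K columns,
each jump lowers the sequence of parts by at least one, and the total descent
is at most K. *)
Lemma jumps_le K n (mu : intpart n) (la : intpart n.+1) :
  interlace mu la -> narrow K la -> (jumps mu la <= K)%N.
Proof.
move=> h bd.
have -> : jumps mu la = (\sum_(i < n) (part la i.+1 < part mu i))%N.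
  rewrite /jumps -sum1_card big_mkcond /=; apply: eq_bigr => i _.
  by rewrite inE; case: ltnP.
case: bd => l0.
  have le : (\sum_(i < n) (part la i.+1 < part mu i) <= \sum_(i < n) (i < K))%N.
    apply: leq_sum => i _; have [_|Ki] := ltnP i K; first exact: leq_b1.
    have -> : part mu i = 0%N; last by rewrite ltn0.
    apply/eqP; rewrite -leqn0 -l0; apply: leq_trans (interlace_part _ h) _.
    exact: part_sorted.
  apply: leq_trans le _; elim: (n) => [|m IH]; first by rewrite big_ord0.
  rewrite big_ord_recr /=; case: ltnP => mK; last by rewrite addn0.
  rewrite addn1; apply: leq_ltn_trans mK.
  by rewrite -[leqRHS]card_ord -sum1_card; apply: leq_sum => i _; exact: leq_b1.
apply: leq_trans l0.
suff le m : (m <= n)%N ->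
   (\sum_(i < m) (part la i.+1 < part mu i) + part la m <= part la 0)%N.
  exact: leq_trans (leq_addr _ _) (le n (leqnn n)).
elim: m => [|m IH] mn; first by rewrite big_ord0.
apply: leq_trans (IH (ltnW mn)); rewrite big_ord_recr /= -addnA leq_add2l.
have /interlaceP/(_ (Ordinal mn))/= /andP[h1 h2] := h.
by case: ltnP => h3; [exact: leq_trans h3 h2|exact: leq_trans h1 h2].
Qed.

Lemma interlace_exists n (la : intpart n.+1) : exists mu : intpart n, interlace mu la.
Proof.
have [|mu muE] := @intpart_of_fun n (part la); first by move=> i _; exact: part_sorted.
by exists mu; apply/interlaceP => i; rewrite muE leqnn part_sorted.
Qed.

(** Iterated branching; a term t records an interlacing chain ending in la by its
exponents, a for the variables and b for the factors 1 - p x. The bound on b is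
what makes the weights of the later averaging argument bounded. *)
Lemma tableaux n (la : intpart n) :
  exists (I : finType) (a b : I -> 'I_n -> nat),
  [/\ (0 < #|I|)%N, forall t, (\sum_(i < n) a t i = psize la)%N,
    forall K, narrow K la -> forall t i, (b t i <= K)%N &
    forall x, (forall i, 0 <= x i <= 1) ->
    geval p la x = \sum_t \prod_(i < n) (x i ^+ a t i * (1 - p * x i) ^+ b t i)].
Proof.
elim: n la => [|n IH] la.
  exists unit, (fun _ _ => 0%N), (fun _ _ => 0%N); split=> //.
  - by rewrite card_unit.
  - by move=> _; rewrite /psize !big_ord0.
  move=> x _; have := vandermonde_geval p la x.
  rewrite /vandermonde /alternant !det_mx00 mul1r => ->.
  by rewrite (big_pred1 tt) ?big_ord0 // => -[].
pose s := [seq mu <- parts n (part la 0).+1 | interlace mu la].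
have s_int k : interlace (tnth (in_tuple s) k) la.
  by have := mem_tnth k (in_tuple s); rewrite mem_filter => /andP[].
pose W k := cid (IH (tnth (in_tuple s) k)).
pose I (k : 'I_(size s)) : finType := sval (W k).
pose Wa k := cid (svalP (W k)).
pose Wb k := cid (svalP (Wa k)).
have H k := svalP (Wb k).
pose a k : I k -> 'I_n -> nat := sval (Wa k).
pose b k : I k -> 'I_n -> nat := sval (Wb k).
(* the exponents of a chain, extended by those of its last step *)
pose ext (u : 'I_n -> nat) v (i : 'I_n.+1) :=
  if unlift ord_max i is Some j then u j else v.
have extl u v j : ext u v (lift ord_max j) = u j by rewrite /ext liftK.
have extm u v : ext u v ord_max = v by rewrite /ext unlift_none.
have widl (j : 'I_n) : widen_ord (leqnSn n) j = lift ord_max j.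
  by apply/val_inj; rewrite /= /bump leqNgt ltn_ord.
exists {k : 'I_(size s) & I k},
  (fun t => ext (a _ (tagged t)) (psize la - psize (tnth (in_tuple s) (tag t)))%N),
  (fun t => ext (b _ (tagged t)) (jumps (tnth (in_tuple s) (tag t)) la)).
split.
- have [mu mula] := interlace_exists la.
  have mus : mu \in s.
    by rewrite mem_filter mula mem_parts_le // ltnS interlace_part.
  rewrite -index_mem in mus; have [/card_gt0P[t _] _ _ _] := H (Ordinal mus).
  by apply/card_gt0P; exists (Tagged I t).
- move=> [k t]; rewrite big_ord_recr /= extm.
  under eq_bigr => j _ do rewrite widl extl.
  have [_ -> _ _] := H k.
  by rewrite subnKC // interlace_size.
- move=> K bd [k t] i; rewrite /ext; case: unliftP => [j _|_] /=.
    have [_ _ + _] := H k; apply; exact: narrow_interlace bd.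
  exact: jumps_le.
move=> x x01; rewrite (branching p1 p0 (ltnSn (part la 0)) x01).
rewrite -big_filter -/s big_tnth.
rewrite -(sig_big_dep xpredT (fun _ _ => true)
 (fun (k : 'I_(size s)) (t : I k) => \prod_(i < n.+1) (x i ^+ ext (a k t) (psize la - psize (tnth (in_tuple s) k))%N i
   * (1 - p * x i) ^+ ext (b k t) (jumps (tnth (in_tuple s) k) la) i))) /=.
apply: eq_bigr => k _; have [_ _ _ ->] := H k; last by move=> i; exact: x01.
rewrite big_distrr /=; apply: eq_bigr => t _.
rewrite big_ord_recr /= !extm mulrC; congr (_ * _).
by apply: eq_bigr => j _; rewrite widl !extl.
Qed.
End Tableaux.

(** * Positivity, growth and symmetry *)

Section EvalBounds.
Variables (R : realType) (p : R).
Hypotheses (p0 : 0 < p) (p1 : p < 1).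

Let q0 : 0 < 1 - p. Proof. by rewrite subr_gt0. Qed.

Lemma weight_itv (z : R) : 0 <= z <= 1 -> 1 - p <= 1 - p * z <= 1.
Proof.
move=> /andP[z0 z1]; rewrite gerBl mulr_ge0 ?(ltW p0) // andbT lerD2l lerN2.
by rewrite ler_piMr // ltW.
Qed.

Lemma geval_gt0 n (la : intpart n) x :
  (forall i, 0 < x i <= 1) -> 0 < geval p la x.
Proof.
move=> x01; have [I [a [b [/card_gt0P[t _] _ _ ->]]]] := tableaux p0 p1 la; last first.
  by move=> i; have /andP[/ltW-> ->] := x01 i.
have pos u : 0 < \prod_(i < n) (x i ^+ a u i * (1 - p * x i) ^+ b u i).
  apply: prodr_gt0 => i _; have /andP[xi0 xi1] := x01 i.
  rewrite mulr_gt0 ?exprn_gt0 //.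
  have /weight_itv/andP[w _] : 0 <= x i <= 1 by rewrite ltW.
  exact: lt_le_trans q0 w.
by rewrite (bigD1 t) //= ltr_wpDr // sumr_ge0 // => u _; exact: ltW.
Qed.

Lemma geval_ge0 n (la : intpart n) x :
  (forall i, 0 <= x i <= 1) -> 0 <= geval p la x.
Proof.
move=> x01; have [I [a [b [_ _ _ ->]]]] := tableaux p0 p1 la => //.
apply: sumr_ge0 => u _; apply: prodr_ge0 => i _; have /andP[xi0 xi1] := x01 i.
rewrite mulr_ge0 ?exprn_ge0 //.
by have /andP[le _] := weight_itv (x01 i); exact: le_trans (ltW q0) le.
Qed.

Definition geval1 n (la : intpart n) : R := geval p la (fun=> 1).

Lemma geval1_gt0 n (la : intpart n) : 0 < geval1 la.
Proof. by apply: geval_gt0 => i; rewrite ltr01 lexx. Qed.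

Lemma grothendieck1E n (la : intpart n) : grothendieck1 p la = geval1 la.
Proof. by []. Qed.

(** Each term of the chain expansion is at most s^|la| at x and at least
(1 - p)^(n n) at 1, because every exponent of 1 - p x is at most n. *)
Lemma geval_le n (la : intpart n) x s :
  s <= 1 -> (forall i, 0 <= x i <= s) ->
  geval p la x <= (1 - p) ^- (n * n) * s ^+ psize la * geval1 la.
Proof.
move=> s1 xs; have [I [a [b [_ aE bE gE]]]] := tableaux p0 p1 la.
rewrite /geval1 !gE; try by move=> i; rewrite ?ler01 ?lexx //; have := xs i; lra.
rewrite big_distrr /=; apply: ler_sum => t _.
apply: (@le_trans _ _ (s ^+ psize la)).
  rewrite -(aE t) -prodrXr; apply: ler_prod => i _; have /andP[xi0 xis] := xs i.
  have /weight_itv/andP[w0 w1] : 0 <= x i <= 1 by rewrite xi0 (le_trans xis).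
  have w0' : 0 <= 1 - p * x i by apply: le_trans (ltW q0) w0.
  rewrite mulr_ge0 ?exprn_ge0 //= -[leRHS]mulr1 ler_pM ?exprn_ge0 //.
    by rewrite lerXn2r ?nnegrE // (le_trans xi0).
  exact: exprn_ile1.
have sp : 0 <= s ^+ psize la.
  have [n0|n0] := posnP n; last by have /andP[? ?] := xs (Ordinal n0); rewrite exprn_ge0 //; lra.
  rewrite /psize big1 // => i _.
  by have := ltn_ord i; rewrite [X in (_ < X)%N]n0.
rewrite mulrAC -[leLHS]mul1r ler_wpM2r // mulrC.
rewrite ler_pdivlMr ?exprn_gt0 // mul1r.
apply: (@le_trans _ _ (\prod_(i < n) (1 - p) ^+ n)).
  by rewrite prodr_const card_ord -exprM.
apply: ler_prod => i _; rewrite exprn_ge0 ?(ltW q0) //= expr1n mul1r mulr1.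
by apply: ler_wiXn2l; rewrite ?(ltW q0) ?gerBl ?(ltW p0) ?bE //; exact: narrow_self.
Qed.

Lemma geval_ratio_le n (la : intpart n) x s :
  s <= 1 -> (forall i, 0 <= x i <= s) ->
  geval p la x / geval1 la <= (1 - p) ^- (n * n) * s ^+ psize la.
Proof. by move=> s1 xs; rewrite ler_pdivrMr ?geval1_gt0 // geval_le. Qed.

(** Permuting the points changes the alternant and the Vandermonde determinant by
the same sign. *)
Lemma geval_perm n (la : intpart n) x (s : 'S_n) :
  (forall i, 0 <= x i <= 1) -> geval p la (x \o s) = geval p la x.
Proof.
move: x; apply: cube_density; last 1 first.
- move=> x x01 vx; apply: (mulfI vx).
  have sgn : (-1) ^+ s != 0 :> R by rewrite signr_eq0.
  have vE : vandermonde (x \o s) = (-1) ^+ s * vandermonde x.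
    rewrite /vandermonde -det_perm -det_mulmx -row_permE; congr (\det _).
    by apply/matrixP => i j; rewrite !mxE.
  apply: (mulfI sgn); rewrite mulrA -vE !vandermonde_geval /alternant -det_perm -det_mulmx -row_permE.
  by congr (\det _); apply/matrixP => i j; rewrite !mxE.
- by apply: (line_poly_comp (h := fun x => x \o s)); last exact: line_poly_meval.
- exact: line_poly_meval.
Qed.

Lemma psize0_part n (la : intpart n) i : part la 0 = 0%N -> part la i = 0%N.
Proof. by move=> l0; apply/eqP; rewrite -leqn0 -l0 part_sorted. Qed.

Lemma geval_empty n (la : intpart n) x :
  part la 0 = 0%N -> (forall i, 0 <= x i <= 1) -> geval p la x = 1.
Proof.
elim: n la x => [|n IH] la x la0 x01.
  have := vandermonde_geval p la x.
  by rewrite /vandermonde /alternant !det_mx00 mul1r.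
rewrite (@branching _ _ n la 1 x p1 p0) ?la0 //.
have [|mu muE] := @intpart_of_fun n (fun=> 0%N); first by [].
have mu0 i : part mu i = 0%N.
  by have [ni|ni] := ltnP i n; [exact: (muE (Ordinal ni))|rewrite part_out].
have la_0 i : part la i = 0%N by exact: psize0_part.
have la_mu : interlace mu la.
  by apply/interlaceP => i; rewrite mu0 !la_0.
rewrite -big_filter (perm_big [:: mu]) /=; last first.
  apply: uniq_perm => //; first by rewrite filter_uniq // parts_uniq.
  move=> nu; rewrite mem_filter !inE; apply/andP/eqP => [[/interlaceP h _]|->].
    apply: eq_intpart => i; rewrite mu0.
    by apply/eqP; rewrite -leqn0 -(la_0 i); case/andP: (h i).
  by rewrite la_mu mem_parts_le // mu0.
rewrite big_seq1 IH ?mulr1 ?mu0 //; last by move=> i; exact: x01.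
have -> : psize la = 0%N by rewrite /psize big1.
have -> : jumps mu la = 0%N.
  by apply/eqP; rewrite -leqn0; apply: jumps_le => //; left.
by rewrite sub0n !expr0 mulr1.
Qed.

Lemma skew_ge0 n (la : intpart n.+1) (mu : intpart n) : 0 <= skew_grothendieck1 p la mu.
Proof.
by rewrite /skew_grothendieck1; case: ifP => // _; rewrite exprn_ge0 ?ltW.
Qed.

(** The branching rule at the value 1 of the last variable, where its weights are
the ones of the coherence relation. *)
Lemma branching1 n (la : intpart n.+1) (x : 'I_n.+1 -> R) :
  (forall i, 0 <= x i <= 1) -> x ord_max = 1 ->
  has_sum (fun mu => skew_grothendieck1 p la mu * geval p mu (but_last x)) (geval p la x).
Proof.
move=> x01 x1.
rewrite (branching p1 p0 (ltnSn (part la 0)) x01) big_mkcond /=.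
under eq_bigr => mu _.
  rewrite x1 expr1n mul1r mulr1 (_ : (if _ then _ else _) = skew_grothendieck1 p la mu * geval p mu (but_last x)); first over.
  by rewrite /skew_grothendieck1; case: ifP => // _; rewrite mul0r.
apply: has_sum_seq => [||mu]; first exact: parts_uniq.
  by move=> mu; rewrite mulr_ge0 ?skew_ge0 // geval_ge0 // => i; exact: x01.
rewrite /skew_grothendieck1; case: ifP => [h|_ _]; last by rewrite mul0r.
by rewrite mem_parts_le // ltnS interlace_part.
Qed.
End EvalBounds.

(** * Coefficients of polynomials that are small near the origin *)

Section Coeffs.
Variable R : realType.

(** This makes the Kronecker substitution of [mpoly_vanish] injective. *)
Lemma eq_digits B n (f g : nat -> nat) :
  (forall i, (i < n)%N -> (f i < B)%N) -> (forall i, (i < n)%N -> (g i < B)%N) ->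
  (\sum_(i < n) f i * B ^ i = \sum_(i < n) g i * B ^ i)%N ->
  forall i, (i < n)%N -> f i = g i.
Proof.
elim: n f g => [//|n IH] f g fB gB.
have step (h : nat -> nat) : (\sum_(i < n.+1) h i * B ^ i = h 0 + (\sum_(i < n) h i.+1 * B ^ i) * B)%N.
  rewrite big_ord_recl /= expn0 muln1 big_distrl /=; congr (_ + _)%N.
  by apply: eq_bigr => i _; rewrite /bump /= add1n expnSr mulnA.
rewrite !step => e.
have B0 : (0 < B)%N by exact: leq_ltn_trans (fB 0%N isT).
have e0 : f 0%N = g 0%N.
  have := congr1 (modn^~ B) e; rewrite ![(_ + _ * B)%N]addnC !modnMDl.
  by rewrite !modn_small ?fB ?gB.
move: e; rewrite e0 => /addnI/eqP; rewrite eqn_pmul2r // => /eqP e [|i] ilt //.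
by apply: (IH (f \o succn) (g \o succn)) => // j jn; [exact: fB|exact: gB].
Qed.

(** Substituting u^(B^i) for the i-th variable, with B above all exponents, keeps
distinct monomials distinct. *)
Lemma mpoly_vanish n (P : mpoly n R) :
  (forall x, (forall i, 0 <= x i <= 1) -> meval x P = 0) -> P = 0.
Proof.
move=> P0; pose B := (msize P).+1.
pose code (m : multinom n) := (\sum_(i < n) m i * B ^ i)%N.
pose q : {poly R} := \sum_(m <- msupp P) mcoeff m P *: 'X^(code m).
have q0 : q = 0.
  apply: poly0_itv => u /andP[u0 u1].
  rewrite -(P0 (fun i => u ^+ (B ^ i))); last first.
    by move=> i; rewrite exprn_ge0 ?exprn_ile1 // ltW.
  rewrite mevalE horner_sum; apply: eq_bigr => m _.
  rewrite hornerZ hornerXn /code -prodrXr; congr (_ * _).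
  by apply: eq_bigr => i _; rewrite -exprM mulnC.
apply/mpolyP => m; rewrite mcoeff0.
have [mP|/memN_msupp_eq0->//] := boolP (m \in msupp P).
have := congr1 (fun r : {poly R} => r`_(code m)) q0.
rewrite coef0 /q coef_sum (bigD1_seq m) ?msupp_uniq //= coefZ coefXn eqxx mulr1.
rewrite big_seq_cond big1 ?addr0 // => m' /andP[m'P m'm].
rewrite coefZ coefXn; case: eqP => [e|_]; last by rewrite mulr0.
have dig k : k \in msupp P -> forall i, (i < n)%N -> (nth 0%N k i < B)%N.
  move=> kP i lt; rewrite -[i]/(val (Ordinal lt)) -(mnm_nth 0%N).
  rewrite /B ltnS; apply: leq_trans (ltnW (msize_mdeg_lt kP)).
  by rewrite mdegE (bigD1 (Ordinal lt)) //= leq_addr.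
case/eqP: m'm; apply/mnmP => i; rewrite !(mnm_nth 0%N).
apply: (eq_digits (dig _ m'P) (dig _ mP)) => //.
by rewrite /code in e; under eq_bigr => j _ do rewrite -(mnm_nth 0%N m' j);
   under [RHS]eq_bigr => j _ do rewrite -(mnm_nth 0%N m j).
Qed.

(** Divide by the variable repeatedly: the constant term is O(s), hence zero. *)
Lemma poly_small (q : {poly R}) C N :
  (forall s, 0 < s <= 1 -> `|q.[s]| <= C * s ^+ N) ->
  forall e, (e < N)%N -> q`_e = 0.
Proof.
elim: N q => [//|N IH] q qs.
pose q' := drop_poly 1 q.
have qE : q = q' * 'X + (q`_0)%:P.
  apply/polyP => -[|i]; rewrite coefD coefMX coefC /= ?add0r //.
  by rewrite coef_drop_poly addr0 addn1.
pose D := \sum_(i < size q') `|q'`_i|.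
have q'D s : 0 < s <= 1 -> `|q'.[s]| <= D.
  move=> /andP[s0 s1]; rewrite horner_coef; apply: le_trans (ler_norm_sum _ _ _) _.
  apply: ler_sum => i _; rewrite normrM ler_piMr // ger0_norm ?exprn_ge0 ?(ltW s0) //.
  by rewrite exprn_ile1 // ltW.
have C0 : 0 <= C.
  by have := qs 1; rewrite ltr01 lexx expr1n mulr1 => /(_ isT); apply: le_trans.
have D0 : 0 <= D by apply: sumr_ge0.
have q00 : q`_0 = 0.
  apply/eqP; rewrite -normr_le0; apply/ler_addgt0Pr => e e0; rewrite add0r.
  have CD : 0 < C + D + 1 by rewrite ltr_wpDl // addr_ge0.
  (* small enough for (C + D) s <= e *)
  pose s := Num.min 1 (e / (C + D + 1)).
  have s0 : 0 < s by rewrite lt_min ltr01 divr_gt0.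
  have s1 : s <= 1 by rewrite ge_min lexx.
  have ss : 0 < s <= 1 by rewrite s0.
  have : `|q`_0| <= C * s + s * D.
    have -> : q`_0 = q.[s] - s * q'.[s] by rewrite {2}qE !hornerE; ring.
    apply: le_trans (ler_normB _ _) _; apply: lerD.
      apply: le_trans (qs s ss) _; rewrite ler_wpM2l // exprS ler_piMr ?(ltW s0) //.
      by rewrite exprn_ile1 // ltW.
    by rewrite normrM ger0_norm ?(ltW s0) // ler_wpM2l ?(ltW s0) // q'D.
  move=> /le_trans; apply; rewrite [s * D]mulrC -mulrDl.
  apply: (@le_trans _ _ ((C + D + 1) * s)); first by rewrite ler_wpM2r ?(ltW s0) // lerDl.
  by rewrite mulrC -ler_pdivlMr // ge_min lexx orbT.
case=> [_ //|e]; rewrite ltnS => eN.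
have -> : q`_e.+1 = q'`_e by rewrite coef_drop_poly addn1.
apply: IH eN => s ss; have /andP[s0 s1] := ss.
have := qs s ss; rewrite {1}qE q00 !hornerE normrM (ger0_norm (ltW s0)) exprSr mulrA.
by rewrite ler_pM2r.
Qed.

(** Along each ray from the origin this is [poly_small]; so each homogeneous part
of degree below N vanishes on the cube. *)
Lemma mpoly_small n (P : mpoly n R) C N :
  (forall s x, 0 < s <= 1 -> (forall i, 0 <= x i <= s) ->
     `|meval x P| <= C * s ^+ N) ->
  forall m, (mdeg m < N)%N -> mcoeff m P = 0.
Proof.
move=> Ps m mN.
pose Q : mpoly n R := \sum_(k <- msupp P | mdeg k == mdeg m) mcoeff k P *: mpolyX R k.
have Q0 : Q = 0.
  apply: mpoly_vanish => y y01.
  pose q : {poly R} := \sum_(k <- msupp P) (mcoeff k P * \prod_i y i ^+ k i) *: 'X^(mdeg k).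
  have <- : q`_(mdeg m) = meval y Q.
    rewrite /q /Q coef_sum raddf_sum /= [RHS]big_mkcond /=; apply: eq_bigr => k _.
    rewrite coefZ coefXn mevalZ mevalX eq_sym.
    by case: ifP => _; rewrite ?mulr1 ?mulr0.
  apply: (poly_small (C := C) (N := N)) => // s /andP[s0 s1].
  have -> : q.[s] = meval (fun i => s * y i) P.
    rewrite /q horner_sum mevalE; apply: eq_bigr => k _.
    rewrite hornerZ hornerXn -mulrA; congr (_ * _).
    under [RHS]eq_bigr => i _ do rewrite exprMn.
    by rewrite big_split /= prodrXr -mdegE mulrC.
  apply: Ps => [|i]; first by rewrite s0.
  have /andP[yi0 yi1] := y01 i.
  by rewrite mulr_ge0 ?(ltW s0) //= ler_piMr // ltW.
have [mP|/memN_msupp_eq0//] := boolP (m \in msupp P).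
have := congr1 (mcoeff m) Q0; rewrite mcoeff0 /Q raddf_sum /= -big_filter.
rewrite (bigD1_seq m) ?filter_uniq ?msupp_uniq ?mem_filter ?eqxx //=.
rewrite mcoeffZ mcoeffX eqxx mulr1 big1 ?addr0 // => k /negPf km.
by rewrite mcoeffZ mcoeffX km mulr0.
Qed.

(** The image in several variables of a truncated power series in the i-th one. *)
Definition upoly n B (t : nat -> R) (i : 'I_n) : mpoly n R :=
  \sum_(k < B) t k *: (mpolyX R (mnm1 i)) ^+ k.

Lemma mcoeff_prod_upoly n B (t : 'I_n -> nat -> R) (m : multinom n) :
  (forall i, (m i < B)%N) ->
  mcoeff m (\prod_(i < n) upoly B (t i) i) = \prod_(i < n) t i (m i).
Proof.
move=> mB; rewrite /upoly bigA_distr_bigA /= raddf_sum /=.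
under eq_bigr => f _.
  rewrite scaler_prod.
  rewrite (_ : \prod_(i < n) mpolyX R (mnm1 i) ^+ f i = mpolyX R (Multinom [tuple (f i : nat) | i < n])); last first.
    rewrite [RHS]mpolyXE_id; apply: eq_bigr => i _; congr (_ ^+ _).
    by rewrite multinomE tnth_mktuple.
  rewrite mcoeffZ mcoeffX; over.
rewrite /=.
pose f0 : {ffun 'I_n -> 'I_B} := [ffun i => Ordinal (mB i)].
have f0m : Multinom [tuple (f0 i : nat) | i < n] = m.
  by apply/mnmP => i; rewrite multinomE tnth_mktuple ffunE.
rewrite (bigD1 f0) //= [X in _ + X]big1 ?addr0.
  by rewrite f0m eqxx mulr1; apply: eq_bigr => i _; rewrite ffunE.
move=> f /negPf ff0; case: eqP => [e|_]; last by rewrite mulr0.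
move: ff0 => /eqP[]; apply/ffunP => i; rewrite ffunE; apply/val_inj => /=.
by rewrite -e multinomE tnth_mktuple.
Qed.

Lemma mcoeff_det_upoly n B (t : nat -> nat -> R) (m : multinom n) :
  (forall i, (m i < B)%N) ->
  mcoeff m (\det (\matrix_(i, j < n) upoly B (t j) i)) =
  \sum_(s : 'S_n) (-1) ^+ s * \prod_(i < n) t (s i) (m i).
Proof.
move=> mB; rewrite /determinant raddf_sum /=; apply: eq_bigr => s _.
under eq_bigr => i _ do rewrite mxE.
case: (odd_perm s); rewrite ?expr1 ?expr0 ?mulN1r ?mul1r ?mcoeffN.
  by rewrite (mcoeff_prod_upoly (fun i : 'I_n => t (s i))).
by rewrite (mcoeff_prod_upoly (fun i : 'I_n => t (s i))).
Qed.

Lemma upoly_horner n B (q : {poly R}) (i : 'I_n) : (size q <= B)%N ->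
  upoly B (fun k => q`_k) i = (map_poly (@mpolyC n R) q).[mpolyX R (mnm1 i)].
Proof.
move=> qB; rewrite (@horner_coef_wide _ B) ?(leq_trans (size_poly _ _)) //.
by apply: eq_bigr => k _; rewrite coef_map /= mul_mpolyC.
Qed.

Lemma meval_upoly n B (t : nat -> R) (i : 'I_n) x :
  meval x (upoly B t i) = \sum_(k < B) t k * x i ^+ k.
Proof.
rewrite raddf_sum; apply: eq_bigr => k _.
by rewrite /= mevalZ rmorphXn /= mevalXU.
Qed.

Lemma perm_homo_id n (s : 'S_n) : (forall i j : 'I_n, (i < j)%N -> (s i < s j)%N) -> s = 1%g.
Proof.
move=> smono.
have ge (i : 'I_n) : (i <= s i)%N.
  case: i => i; elim: i => [//|i IH] lt /=.
  have lt' := ltnW lt.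
  apply: leq_ltn_trans (IH lt') _; exact: smono.
have : (\sum_(i < n) (s i - i) = 0)%N.
  rewrite sumnB => [|i _]; last exact: ge.
  by rewrite [X in (X - _)%N](_ : _ = \sum_(i < n) i)%N ?subnn // [RHS](reindex_inj (@perm_inj _ s)).
move/eqP; rewrite sum_nat_eq0 => /forallP le.
apply/permP => i; rewrite perm1; apply/val_inj/eqP => /=.
by rewrite eqn_leq ge andbT -subn_eq0; exact: le.
Qed.
End Coeffs.

(** * Triangularity of the Grothendieck polynomials *)

Section Triangular.
Variables (R : realType) (p : R).

(** The univariate polynomial whose values fill a column of the alternant. *)
Definition column_poly l j : {poly R} := 'X^l * (1 - p%:P * 'X) ^+ j.

Lemma coef_column_poly l j k :
  (k <= l)%N -> (column_poly l j)`_k = (k == l)%:R.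
Proof.
move=> kl; rewrite coefXnM ltn_neqAle kl andbT.
case: eqP => [->|//]; rewrite /= subnn -horner_coef0 !hornerE.
by rewrite ?mulr0 ?subr0 ?expr1n.
Qed.

Lemma column_poly_upoly n B l j (i : 'I_n) : (size (column_poly l j) <= B)%N ->
  mpolyX R (mnm1 i) ^+ l * (1 - p *: mpolyX R (mnm1 i)) ^+ j =
  upoly B (fun k => (column_poly l j)`_k) i.
Proof.
move=> lB; rewrite upoly_horner // rmorphM /= map_polyXn hornerM hornerXn.
congr (_ * _); rewrite rmorphXn rmorphB rmorphM /= map_polyC map_polyX rmorph1.
by rewrite ?hornerE map_polyC hornerC -mul_mpolyC.
Qed.

(** The strictly decreasing exponents la_j + n - j of the lowest terms of the
columns. *)
Definition shifted n (la : intpart n) (j : nat) : nat := (part la j + (n - j.+1))%N.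

Lemma sum_shifted n (la : intpart n) :
  (\sum_(i < n) shifted la i = psize la + \sum_(i < n) (n - i.+1))%N.
Proof. by rewrite /shifted big_split. Qed.

Lemma shifted_lt n (la : intpart n) (i j : 'I_n) :
  (i < j)%N -> (shifted la j < shifted la i)%N.
Proof.
move=> ij; rewrite /shifted; have := part_sorted la (ltnW ij).
have := ltn_ord j; lia.
Qed.

Definition mshifted n (la : intpart n) : multinom n :=
  Multinom [tuple shifted la i | i < n].

Lemma mshiftedE n (la : intpart n) i : mshifted la i = shifted la i.
Proof. by rewrite multinomE tnth_mktuple. Qed.

Lemma mdeg_mshifted n (la : intpart n) :
  mdeg (mshifted la) = (psize la + \sum_(i < n) (n - i.+1))%N.
Proof. by rewrite mdegE -sum_shifted; apply: eq_bigr => i _; rewrite mshiftedE. Qed.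

Lemma big_bound n (f : 'I_n -> nat) : exists B, forall i, (f i < B)%N.
Proof.
exists (\max_i f i).+1 => i; rewrite ltnS; exact: leq_bigmax.
Qed.

(** A permutation s contributes only if each exponent of the monomial is at least
the lowest exponent of the column it meets. As the total degree is not larger,
all these inequalities are equalities, and strict monotonicity of both
sequences leaves only the identity. *)
Lemma mcoeff_num n (la mu : intpart n) : (psize mu <= psize la)%N ->
  mcoeff (mshifted mu) (grothendieck_num p la) = (la == mu)%:R.
Proof.
move=> size_le.
have [B1 hB1] := big_bound (fun i => mshifted mu i).
have [B2 hB2] := big_bound (fun j : 'I_n => size (column_poly (shifted la j) j)).
pose B := maxn B1 B2.
have -> : grothendieck_num p la = \det (\matrix_(i, j < n)
    upoly B (fun k => (column_poly (shifted la j) j)`_k) i).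
  congr (\det _); apply/matrixP => i j; rewrite !mxE -column_poly_upoly //.
  by rewrite leq_max (ltnW (hB2 j)) orbT.
rewrite (mcoeff_det_upoly (fun j k => (column_poly (shifted la j) j)`_k)); last first.
  by move=> i; rewrite leq_max hB1.
have key (s : 'S_n) :
    \prod_(i < n) (column_poly (shifted la (s i)) (s i))`_(mshifted mu i) != 0 ->
    forall i : 'I_n, shifted mu i = shifted la (s i).
  move=> /prodf_neq0 nz.
  have ge (i : 'I_n) : (shifted la (s i) <= shifted mu i)%N.
    rewrite leqNgt; apply/negP => lt; have := nz i isT.
    by rewrite mshiftedE coef_column_poly ?(ltnW lt) // (ltn_eqF lt) eqxx.
  have sumE : (\sum_(i < n) (shifted mu i - shifted la (s i)) = 0)%N.
    rewrite sumnB => [|i _]; last exact: ge.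
    have <- : (\sum_(i < n) shifted la i = \sum_(i < n) shifted la (s i))%N.
      by rewrite [LHS](reindex_inj (@perm_inj _ s)).
    by rewrite !sum_shifted subnDr; apply/eqP; rewrite subn_eq0.
  move=> i; apply/eqP; rewrite eqn_leq ge andbT -subn_eq0.
  by move/eqP: sumE; rewrite sum_nat_eq0 => /forallP/(_ i).
have [e|/eqP lamu] := eqVneq la mu; last first.
  rewrite big1 // => s _; apply/eqP; apply/negPn; rewrite mulf_eq0 signr_eq0 /=.
  apply/negP => /key e; apply: lamu.
  have s1 : s = 1%g.
    apply: perm_homo_id => i j ij; rewrite ltnNge; apply/negP => ji.
    have := shifted_lt mu ij; rewrite (e i) (e j) ltnNge; case/negP.
    move: ji; rewrite leq_eqVlt => /orP[/eqP/val_inj->//|]; move/(shifted_lt la); exact: ltnW.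
  apply: eq_intpart => i; have := e i; rewrite s1 perm1 /shifted => /eqP.
  by rewrite eqn_add2r => /eqP.
subst mu; rewrite (bigD1 (1%g : {perm (ordinal n)})) //= odd_perm1 expr0 mul1r big1 ?mul1r; last first.
  by move=> i _; rewrite perm1 mshiftedE coef_column_poly ?eqxx.
rewrite big1 ?addr0 // => s /eqP s1.
apply/eqP/negPn; rewrite mulf_eq0 signr_eq0 /=; apply/negP => /key e; apply: s1.
apply: perm_homo_id => i j ij; rewrite ltnNge; apply/negP => ji.
have := shifted_lt la ij; rewrite (e i) (e j) ltnNge; case/negP.
move: ji; rewrite leq_eqVlt => /orP[/eqP/val_inj->//|]; move/(shifted_lt la); exact: ltnW.
Qed.

(** The Vandermonde determinant is homogeneous. *)
Lemma mcoeff_vandermonde_low n m : (mdeg m < \sum_(i < n) (n - i.+1))%N ->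
  mcoeff m (vandermonde_den R n) = 0.
Proof.
move=> mlt.
have [B1 hB1] := big_bound (fun i => m i).
pose B := maxn B1 n.
have -> : vandermonde_den R n = \det (\matrix_(i, j < n)
    upoly B (fun k => (k == n - j.+1)%N%:R) i).
  congr (\det _); apply/matrixP => i j; rewrite !mxE /upoly.
  have lt : (n - j.+1 < B)%N by rewrite leq_max; have := ltn_ord j; lia.
  rewrite (bigD1 (Ordinal lt)) //= eqxx scale1r big1 ?addr0 // => k.
  by rewrite -val_eqE /= => /negPf->; rewrite scale0r.
rewrite (mcoeff_det_upoly (fun j k => (k == n - j.+1)%N%:R)); last first.
  by move=> i; rewrite leq_max hB1.
rewrite big1 // => s _; apply/eqP/negPn; rewrite mulf_eq0 signr_eq0 /=.
apply/negP => /prodf_neq0 nz; move: mlt; rewrite mdegE.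
have -> : (\sum_(i < n) m i = \sum_(i < n) (n - (s i).+1))%N.
  apply: eq_bigr => i _; apply/eqP; have := nz i isT.
  by case: (m i =P (n - (s i).+1)%N) => // _ /=; rewrite eqxx.
by rewrite [X in (_ < X)%N](reindex_inj (@perm_inj _ s)) ltnn.
Qed.

Definition lower n K : seq (intpart n) :=
  [seq la <- parts n K.+1 | (psize la <= K)%N].

Lemma mem_lower n K (la : intpart n) : (la \in lower n K) = (psize la <= K)%N.
Proof.
rewrite mem_filter andb_idr // => le; apply: mem_parts_le.
by rewrite ltnS (leq_trans (part_le_psize _ _)).
Qed.

Lemma lower_uniq n K : uniq (lower n K).
Proof. by rewrite filter_uniq // parts_uniq. Qed.

(** Multiply by the Vandermonde determinant, which raises the least degree by its
own degree, and read off the coefficients of the shifted partitions by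
increasing size. *)
Lemma grothendieck_free n (D : intpart n -> R) :
  (forall K m, (mdeg m <= K)%N ->
    mcoeff m (\sum_(la <- lower n K) D la *: grothendieck p la) = 0) ->
  forall la, D la = 0.
Proof.
move=> DK; suff main d la : psize la = d -> D la = 0 by move=> la; exact: main.
elim/ltn_ind: d la => d IH mu mud.
pose P := \sum_(la <- lower n d) D la *: grothendieck p la.
have : mcoeff (mshifted mu) (P * vandermonde_den R n) = 0.
  rewrite mcoeffM big1 // => k /eqP/(congr1 mdeg).
  move=> /esym; rewrite mdegD => /esym/(etrans (esym (mdeg_mshifted mu))) e.
  rewrite mud in e.
  have [le|gt] := leqP (mdeg k.1) d; first by rewrite DK ?mul0r.
  rewrite mcoeff_vandermonde_low ?mulr0 //.
  by rewrite -(ltn_add2l d) [ltnRHS]e ltn_add2r.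
rewrite /P big_distrl /= raddf_sum /=.
under eq_bigr => la _ do rewrite -scalerAl -grothendieckP mcoeffZ.
rewrite (bigD1_seq mu) ?lower_uniq ?mem_lower ?mud //= mcoeff_num // eqxx mulr1.
rewrite big_seq_cond big1 ?addr0 // => la /andP[]; rewrite mem_lower => le lamu.
move: le; rewrite leq_eqVlt => /orP[/eqP e|lt]; last by rewrite (IH _ lt) ?mul0r.
by rewrite mcoeff_num ?e ?mud // (negPf lamu) mulr0.
Qed.

Hypotheses (p0 : 0 < p) (p1 : p < 1).

(** By [geval_le] the value is O(s^|la|) on [0,s]^n. *)
Lemma mcoeff_grothendieck_low n (la : intpart n) m :
  (mdeg m < psize la)%N -> mcoeff m (grothendieck p la) = 0.
Proof.
apply: (@mpoly_small _ _ _ ((1 - p) ^- (n * n) * geval1 p la)) => s x /andP[s0 s1] xs.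
rewrite ger0_norm; last first.
  by apply: geval_ge0 => // i; have := xs i; lra.
by rewrite mulrAC; apply: geval_le.
Qed.

(** Only partitions of size at most the degree of the monomial contribute, so the
coefficient is the one of a polynomial. *)
Lemma fsum_mcoeff n (D : intpart n -> R) m K : (mdeg m <= K)%N ->
  \sum_(la \in [set: intpart n])
     (D la * (mcoeff m (grothendieck p la) / grothendieck1 p la)) =
  mcoeff m (\sum_(la <- lower n K) (D la / geval1 p la) *: grothendieck p la).
Proof.
move=> mK; rewrite (@fsbigE _ _ _ _ _ (lower n K) _ (lower_uniq n K)) //; last first.
  move=> la _; rewrite mem_lower -ltnNge => lt.
  by rewrite mcoeff_grothendieck_low ?mul0r ?mulr0 // (leq_ltn_trans mK).
rewrite raddf_sum /=; apply: eq_big => [la|la _]; first by rewrite in_setT.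
by rewrite mcoeffZ grothendieck1E mulrAC mulrA.
Qed.

Lemma coeff_identity_uniq n (M M' : intpart n -> R) :
  (forall m : multinom n, 
  \sum_(la \in [set: intpart n])
     (M la * (mcoeff m (grothendieck p la) / grothendieck1 p la)) =
  \sum_(la \in [set: intpart n])
     (M' la * (mcoeff m (grothendieck p la) / grothendieck1 p la))) ->
  M = M'.
Proof.
move=> e; apply/funext => la.
suff : M la / geval1 p la - M' la / geval1 p la = 0.
  move/eqP; rewrite subr_eq0 => /eqP/(mulIf _)->//.
  by rewrite invr_eq0 gt_eqF // geval1_gt0.
move: la; apply: grothendieck_free => K m mK.
under eq_bigr => la _ do rewrite scalerBl.
rewrite sumrB raddfB /= -!fsum_mcoeff // e subrr //.
Qed.
End Triangular.

(** * Generating functions on the cube determine the measure *)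

Section GenFun.
Variables (R : realType) (p : R).
Hypotheses (p0 : 0 < p) (p1 : p < 1).

Lemma has_sum_tail (T : choiceType) (f h : T -> R) l H c (s : seq T) : uniq s ->
  has_sum f l -> has_sum h H -> 0 <= c ->
  (forall x, x \notin s -> f x <= c * h x) -> l - \sum_(x <- s) f x <= c * H.
Proof.
move=> us fl hH c0 fh.
pose f' x := if x \in s then f x else 0.
have f'0 x : 0 <= f' x by rewrite /f'; case: ifP => // _; exact: fl.1.
have f's : has_sum f' (\sum_(x <- s) f x).
  rewrite (eq_big_seq f'); last by move=> x xs; rewrite /f' xs.
  by apply: has_sum_seq => // x /negPf xs; rewrite /f' xs.
rewrite lerBlDl; apply: (has_sum_le _ fl (has_sumD f's (has_sumZ c0 hH))) => x.
rewrite /f'; case: ifPn => [_|/fh]; last by rewrite add0r.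
by rewrite lerDl mulr_ge0 // hH.1.
Qed.

Lemma prod_diff_le (I : Type) (r : seq I) (a b : I -> R) B e :
  1 <= B -> 0 <= e -> (forall i, `|a i| <= B) -> (forall i, `|b i| <= B) ->
  (forall i, `|a i - b i| <= e) ->
  `|\prod_(i <- r) a i - \prod_(i <- r) b i| <= (size r)%:R * B ^+ size r * e.
Proof.
move=> B1 e0 aB bB ab; have B0 : 0 <= B by exact: le_trans B1.
elim: r => [|i r IH]; first by rewrite !big_nil subrr normr0 !mul0r.
rewrite !big_cons /=.
have -> : a i * \prod_(j <- r) a j - b i * \prod_(j <- r) b j =
  a i * (\prod_(j <- r) a j - \prod_(j <- r) b j) + (a i - b i) * \prod_(j <- r) b j by ring.
apply: le_trans (ler_normD _ _) _; rewrite !normrM.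
have le1 : `|\prod_(j <- r) b j| <= B ^+ size r.
  rewrite normr_prod -[leRHS]mulr1; elim: (r) => [|j s IHs]; first by rewrite big_nil mulr1.
  by rewrite big_cons /= exprS -mulrA ler_pM // prodr_ge0.
apply: (@le_trans _ _ (B * ((size r)%:R * B ^+ size r * e) + e * B ^+ size r)).
  by apply: lerD; apply: ler_pM; rewrite ?aB ?ab.
rewrite exprS -natr1 mulrDl mul1r mulrDl.
have Bs : 0 <= B ^+ size r by rewrite exprn_ge0.
apply: lerD; first by rewrite le_eqVlt; apply/orP; left; apply/eqP; ring.
by rewrite mulrC ler_wpM2r // ler_peMl.
Qed.

(** The generating function identity for values on the cube instead of power
series: positivity makes it meaningful at all points, including 1^n. *)
Definition cube_gf n (M : intpart n -> R) (phi : R -> R) : Prop :=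
  forall x : 'I_n -> R, (forall i, 0 <= x i <= 1) ->
  has_sum (fun la => M la * (geval p la x / geval1 p la)) (\prod_(i < n) phi (x i)).

Definition taylor_bounded (f : R -> R) : Prop :=
  forall K, exists C, forall x, 0 <= x <= 1 ->
  `|f x - \sum_(k < K) taylor_coef f k * x ^+ k| <= C * x ^+ K.

Lemma geval_ratio1 n (la : intpart n) : geval p la (fun=> 1) / geval1 p la = 1.
Proof. by rewrite divff // gt_eqF // geval1_gt0. Qed.

Lemma cube_gf_mass n (M : intpart n -> R) phi :
  cube_gf M phi -> has_sum M (phi 1 ^+ n).
Proof.
move=> gf; have := gf (fun=> 1); rewrite prodr_const card_ord => /(_ _) h.
apply: (eq_has_sum _ (h _)) => [la|i]; last by rewrite ler01 lexx.
by rewrite geval_ratio1 mulr1.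
Qed.

(** On [0,s]^n the partitions of size above K contribute O(s^(K+1)), and so does
replacing phi by its Taylor polynomial; the difference of the two remaining
polynomials has no term of degree at most K by [mpoly_small]. *)
Lemma cube_gf_coeffs n (M : intpart n -> R) phi :
  taylor_bounded phi -> cube_gf M phi ->
  forall m : multinom n,
  \sum_(la \in [set: intpart n])
     (M la * (mcoeff m (grothendieck p la) / grothendieck1 p la)) =
  \prod_(i < n) taylor_coef phi (m i).
Proof.
move=> tb gf m; pose K := mdeg m.
rewrite (fsum_mcoeff p0 p1 M (leqnn K)).
have mK i : (m i < K.+1)%N by rewrite ltnS /K mdegE (bigD1 i) //= leq_addr.
rewrite -(mcoeff_prod_upoly (fun _ : 'I_n => taylor_coef phi) mK).
apply/eqP; rewrite -subr_eq0 -raddfB; apply/eqP.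
have [C0 hC0] := tb 0%N; have [C1 hC1] := tb K.+1.
have M0 := (cube_gf_mass gf).1.
pose A := (1 - p) ^- (n * n) * phi 1 ^+ n.
pose B := 1 + `|C0| + `|C1|.
have B1 : 1 <= B by rewrite /B -addrA lerDl addr_ge0.
apply: (@mpoly_small _ _ _ (A + n%:R * B ^+ n * `|C1|) K.+1) => // s x /andP[s0 s1] xs.
have x01 i : 0 <= x i <= 1 by have := xs i; lra.
have sK : 0 <= s ^+ K.+1 by rewrite exprn_ge0 // ltW.
rewrite raddfB /= raddf_sum rmorph_prod /=.
under [X in _ - X]eq_bigr => i _ do rewrite meval_upoly.
under eq_bigr => la _ do rewrite mevalZ -/(geval p la x) mulrAC -mulrA.
set S := \sum_(la <- _) _; set Q := \prod_(i < n) _.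
pose Pr := \prod_(i < n) phi (x i).
have -> : S - Q = - (Pr - S) + (Pr - Q) by ring.
apply: le_trans (ler_normD _ _) _; rewrite mulrDl; apply: lerD.
  rewrite normrN ger0_norm; last first.
    by rewrite subr_ge0; apply: has_sum_ub (gf x x01) (lower_uniq _ _).
  rewrite /A mulrAC; apply: has_sum_tail (lower_uniq _ _) (gf x x01) (cube_gf_mass gf) _ _.
    by rewrite mulr_ge0 // invr_ge0 exprn_ge0 // subr_ge0 ltW.
  move=> la; rewrite mem_lower -ltnNge => Kla; rewrite mulrC ler_wpM2r //.
  apply: le_trans (geval_ratio_le p0 p1 la s1 xs) _.
  rewrite ler_wpM2l ?invr_ge0 ?exprn_ge0 ?subr_ge0 ?(ltW p1) //.
  by apply: ler_wiXn2l => //; exact: ltW.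
have e0 : 0 <= `|C1| * s ^+ K.+1 by rewrite mulr_ge0.
have near i : `|phi (x i) - \sum_(k < K.+1) taylor_coef phi k * x i ^+ k| <= `|C1| * s ^+ K.+1.
  apply: le_trans (hC1 _ (x01 i)) _; have /andP[xi0 xis] := xs i.
  apply: ler_pM; rewrite ?exprn_ge0 ?ler_norm //; last first.
    by rewrite lerXn2r ?nnegrE // (le_trans xi0).
  have := hC1 1; rewrite ler01 lexx expr1n mulr1 => /(_ isT); exact: le_trans.
have phiB i : `|phi (x i)| <= `|C0|.
  have := hC0 _ (x01 i); rewrite big_ord0 subr0 expr0 mulr1 => /le_trans; apply.
  exact: ler_norm.
have := @prod_diff_le _ (index_enum 'I_n) (fun i => phi (x i)) (fun i => \sum_(k < K.+1) taylor_coef phi k * x i ^+ k) B _ B1 e0.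
have sz : size (index_enum 'I_n) = n by rewrite -[index_enum _]enumT size_enum_ord.
rewrite sz => diff; rewrite -[leRHS]mulrA; apply: diff.
- by move=> i; apply: le_trans (phiB i) _; rewrite /B; have := normr_ge0 C1; lra.
- move=> i; set u := \sum_(k < _) _.
  have -> : u = phi (x i) - (phi (x i) - u) by ring.
  apply: le_trans (ler_normB _ _) _; have := phiB i; have := near i; rewrite -/u.
  have : `|C1| * s ^+ K.+1 <= `|C1|.
    by rewrite ler_piMr // exprn_ile1 // ltW.
  rewrite /B; lra.
- exact: near.
Qed.

Lemma cube_gf_uniq n (M M' : intpart n -> R) phi :
  taylor_bounded phi -> cube_gf M phi -> cube_gf M' phi -> M = M'.
Proof.
move=> tb gf gf'; apply: (coeff_identity_uniq p0 p1) => m.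
by rewrite (cube_gf_coeffs tb gf) (cube_gf_coeffs tb gf').
Qed.
End GenFun.

Import numFieldNormedType.Exports.

(** * Taylor expansion of the factors of Phi *)

Section Taylor.
Variable R : realType.

(** Coefficients of the product of the variable and a power series. *)
Definition shift_seq (T : nat -> R) (k : nat) : R := if k is k'.+1 then T k' else 0.

Lemma sum_shift_seq (T T' : nat -> R) u v x K :
  (forall k, T' k = u * T k + v * shift_seq T k) ->
  \sum_(k < K) T' k * x ^+ k =
  (u + v * x) * (\sum_(k < K) T k * x ^+ k) - v * shift_seq T K * x ^+ K.
Proof.
move=> TE; elim: K => [|K IH]; first by rewrite !big_ord0 /=; ring.
by rewrite !big_ord_recr IH TE /= exprS; ring.
Qed.

(** D k is the k-th derivative on z < 1; the remainder estimate is required up to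
z = 1, where the generating functions are evaluated. The denominators of Phi
do not vanish on z <= 1, so this half-line serves for all factors. *)
Definition smooth_data (f : R -> R) (D : nat -> R -> R) : Prop :=
  [/\ forall z, z < 1 -> D 0%N z = f z,
    forall k (z : R), z < 1 -> is_derive z 1 (D k) (D k.+1 z) &
    forall K, exists C, forall x, 0 <= x <= 1 ->
      `|f x - \sum_(k < K) (D k 0 / k`!%:R) * x ^+ k| <= C * x ^+ K].

Lemma near_lt1 (z : R) : z < 1 -> \forall y \near z, y < 1.
Proof. by move=> z1; exact: lt_nbhsl. Qed.

Lemma smooth_derive1n f D : smooth_data f D ->
  forall k z, z < 1 -> derive1n k f z = D k z.
Proof.
move=> [D0 DS _]; elim=> [|k IH] z z1; first by rewrite derive1n0 D0.
rewrite derive1nS derive1E.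
have := DS k z z1 => -[_ <-]; apply: near_eq_derive.
by near=> y; apply: IH; near: y; exact: near_lt1.
Unshelve. all: by end_near.
Qed.

Lemma smooth_taylor_bounded f D : smooth_data f D -> taylor_bounded f.
Proof.
move=> fD K; have [_ _ /(_ K)[C hC]] := fD; exists C => x x01.
rewrite /taylor_coef; under eq_bigr => k _ do rewrite (smooth_derive1n fD) ?ltr01 //.
exact: hC.
Qed.

Lemma smooth_cst (c : R) : smooth_data (fun=> c) (fun k _ => if k is 0%N then c else 0).
Proof.
split=> [//|[|k] z _|K]; [exact: is_derive_cst|exact: is_derive_cst|].
exists `|c| => x /andP[x0 x1]; case: K => [|K].
  by rewrite big_ord0 subr0 expr0 mulr1.
rewrite big_ord_recl /= fact0 divr1 expr0 mulr1 big1 ?addr0; last first.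
  by move=> i _; rewrite mul0r mul0r.
by rewrite subrr normr0 mulr_ge0 // exprn_ge0.
Qed.

(** Leibniz rule for an affine factor. *)
Definition mul_data u v (D : nat -> R -> R) (k : nat) (z : R) : R :=
  (u + v * z) * D k z + k%:R * v * D k.-1 z.

Lemma is_derive_affine (u v z : R) : is_derive z 1 (fun y => u + v * y) v.
Proof.
have -> : (fun y => u + v * y) = (fun=> u) + (fun=> v) * id by apply/funext.
apply: is_derive_eq.
by rewrite /GRing.scale /= mulr0 addr0 add0r mulr1.
Qed.

Lemma natr_factS (k : nat) : (k.+1`!%:R : R) = k.+1%:R * k`!%:R.
Proof. by rewrite factS natrM. Qed.

Lemma fact_neq0 (k : nat) : (k`!%:R : R) != 0.
Proof. by rewrite pnatr_eq0 -lt0n fact_gt0. Qed.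

Lemma smooth_mul f D u v : smooth_data f D ->
  smooth_data (fun z => (u + v * z) * f z) (mul_data u v D).
Proof.
move=> [D0 DS DT]; split=> [z z1|k z z1|K].
- by rewrite /mul_data D0 // !mul0r addr0.
- have hk := DS k z z1; have hk' := DS k.-1 z z1.
  have := is_derive_affine u v z => ha.
  have -> : mul_data u v D k = (fun y => u + v * y) * D k + (fun=> k%:R * v) * D k.-1.
    by apply/funext.
  apply: is_derive_eq (is_deriveD (is_deriveM ha hk) (is_deriveM (is_derive_cst (k%:R * v) z 1) hk')) _.
  rewrite /mul_data /GRing.scale /= mulr0 addr0.
  case: (k) => [|j] /=; first by rewrite mul0r mul0r addr0 mul1r; ring.
  by rewrite -!natr1; ring.
have [C hC] := DT K; exists ((`|u| + `|v|) * C + `|v * shift_seq (fun k => D k 0 / k`!%:R) K|).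
move=> x x01; have /andP[x0 x1] := x01.
rewrite (@sum_shift_seq (fun k => D k 0 / k`!%:R) (fun k => mul_data u v D k 0 / k`!%:R) u v); last first.
  case=> [|k]; rewrite /mul_data /=; first by rewrite fact0; field.
  have : k.+1%:R != 0 :> R by rewrite pnatr_eq0.
  have := fact_neq0 k.
  by rewrite natr_factS; move: k.+1%:R k`!%:R => c d d0 c0; field; rewrite d0.
set S := \sum_(k < K) _; set t := shift_seq _ K.
have -> : (u + v * x) * f x - ((u + v * x) * S - v * t * x ^+ K) =
  (u + v * x) * (f x - S) + v * t * x ^+ K by ring.
apply: le_trans (ler_normD _ _) _; rewrite [leRHS]mulrDl; apply: lerD; last first.
  by rewrite normrM [`|x ^+ K|]ger0_norm ?exprn_ge0.
rewrite normrM -mulrA; apply: ler_pM => //; last exact: hC.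
apply: le_trans (ler_normD _ _) _; rewrite lerD2l normrM [`|x|]ger0_norm //.
by rewrite ler_piMr.
Qed.

(** Leibniz rule for (u + v z) h = f, solved for the highest derivative of h. *)
Fixpoint div_data u v (D : nat -> R -> R) (k : nat) (z : R) : R :=
  if k is k'.+1 then (D k z - k%:R * v * div_data u v D k' z) / (u + v * z)
  else D 0%N z / (u + v * z).

(** Multiplying the remainder of h by u + v z gives the remainder of f up to one
term of order K, and u + v z stays away from zero. *)
Lemma smooth_div f D u v m : 0 < m ->
  (forall z, z <= 1 -> m <= u + v * z) -> smooth_data f D ->
  smooth_data (fun z => f z / (u + v * z)) (div_data u v D).
Proof.
move=> m0 um [D0 DS DT].
have un z : z <= 1 -> u + v * z != 0.
  by move=> z1; rewrite gt_eqF // (lt_le_trans m0) // um.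
split=> [z z1|k z z1|K].
- by rewrite /= D0.
- have ha := is_derive_affine u v z.
  have hV : is_derive z 1 (fun y => (u + v * y)^-1) (- (u + v * z) ^- 2 * v).
    exact: (@is_deriveV R (fun y : R => u + v * y) z v 1 (un z (ltW z1)) ha).
  elim: k => [|k IH].
    have h0 := DS 0%N z z1.
    have -> : div_data u v D 0 = D 0%N * (fun y => (u + v * y)^-1) by apply/funext.
    apply: is_derive_eq (is_deriveM h0 hV) _; rewrite /GRing.scale /=.
    by field; exact: un (ltW z1).
  have hk := DS k.+1 z z1.
  have -> : div_data u v D k.+1 = (D k.+1 - (fun=> k.+1%:R * v) * div_data u v D k) * (fun y => (u + v * y)^-1).
    by apply/funext.
  apply: is_derive_eq (is_deriveM (is_deriveB hk (is_deriveM (is_derive_cst (k.+1%:R * v) z 1) IH)) hV) _.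
  rewrite /GRing.scale /= mulr0 addr0.
  have -> : (D k.+1 - cst (k.+1%:R * v) * div_data u v D k) z =
    D k.+1 z - k.+1%:R * v * div_data u v D k z by [].
  have := un z (ltW z1).
  rewrite -[k.+2%:R]natr1; move: (D k.+1 z) (D k.+2 z) (div_data u v D k z) k.+1%:R => a b c d w0.
  by field.
have [C hC] := DT K.
pose T' k := div_data u v D k 0 / k`!%:R.
exists ((C + `|v * shift_seq T' K|) / m) => x x01; have /andP[x0 x1] := x01.
have := hC x x01; rewrite (@sum_shift_seq T' (fun k => D k 0 / k`!%:R) u v); last first.
  have u0 : u != 0 by have := un 0 ler01; rewrite mulr0 addr0.
  have uE : u + v * 0 = u by ring.
  case=> [|k]; rewrite /T' /= uE; first by rewrite fact0; field.
  have : k.+1%:R != 0 :> R by rewrite pnatr_eq0.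
  have := fact_neq0 k.
  by rewrite natr_factS; move: k.+1%:R k`!%:R => c d d0 c0; field; rewrite ?d0 ?u0 ?c0.
set S := \sum_(k < K) _; set t := shift_seq _ K => h.
have w := um x x1; have wp : 0 < u + v * x by exact: lt_le_trans w.
rewrite mulrAC ler_pdivlMr //.
apply: (@le_trans _ _ `|(u + v * x) * (f x / (u + v * x) - S)|).
  by rewrite normrM mulrC ler_wpM2r // gtr0_norm.
have -> : (u + v * x) * (f x / (u + v * x) - S) =
   (f x - ((u + v * x) * S - v * t * x ^+ K)) - v * t * x ^+ K by field; rewrite gt_eqF.
apply: le_trans (ler_normB _ _) _; rewrite [leRHS]mulrDl lerD //.
by rewrite normrM [`|x ^+ K|]ger0_norm ?exprn_ge0.
Qed.

End Taylor.

(** * Sums over partitions as limits *)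

Section Exhaustion.
Variable R : realType.

Lemma ler_sum_sub (T : choiceType) (f : T -> R) (s t : seq T) :
  uniq s -> uniq t -> {subset s <= t} -> (forall x, 0 <= f x) ->
  \sum_(x <- s) f x <= \sum_(x <- t) f x.
Proof.
move=> us ut st f0; pose f' x := if x \in t then f x else 0.
have f'0 x : 0 <= f' x by rewrite /f'; case: ifP.
have : has_sum f' (\sum_(x <- t) f' x).
  by apply: has_sum_seq => // x /negPf xt; rewrite /f' xt.
move=> /has_sum_ub/(_ us).
rewrite (eq_big_seq f); last by move=> x /st xt; rewrite /f' xt.
by rewrite (@eq_big_seq _ _ _ _ t f' f) // => x xt; rewrite /f' xt.
Qed.

Lemma parts_mono n B C : (B <= C)%N -> {subset parts n B <= parts n C}.
Proof.
move=> BC la; rewrite !mem_parts => /forallP h; apply/forallP => i.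
exact: leq_trans (h i) BC.
Qed.

Lemma parts_cover n (s : seq (intpart n)) : exists B, {subset s <= parts n B}.
Proof.
elim: s => [|la s [B sB]]; first by exists 0%N.
exists (maxn B (part la 0).+1) => mu; rewrite inE => /orP[/eqP->|/sB].
  by apply: mem_parts_le; rewrite leq_max ltnSn orbT.
by apply: parts_mono; exact: leq_maxl.
Qed.

(** Convergence along the exhaustion by the largest part suffices for nonnegative
families. *)
Lemma has_sum_parts n (f : intpart n -> R) l : (forall la, 0 <= f la) ->
  (forall e, 0 < e -> exists B0, forall B, (B0 <= B)%N ->
     `|\sum_(la <- parts n B) f la - l| <= e) -> has_sum f l.
Proof.
move=> f0 lim; apply: has_sum_intro => // [s us|e e0].
  apply/ler_addgt0Pr => e e0; have [B0 hB] := lim e e0.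
  have [B1 sB] := parts_cover s.
  have := hB _ (leq_maxl B0 B1); rewrite ler_norml => /andP[_].
  rewrite lerBlDl addrC; apply: le_trans; apply: ler_sum_sub => //.
    exact: parts_uniq.
  by move=> x /sB; apply: parts_mono; exact: leq_maxr.
have [B0 hB] := lim e e0; exists (parts n B0); first exact: parts_uniq.
by have := hB _ (leqnn B0); rewrite ler_norml => /andP[]; lra.
Qed.

(** The determinant is affine in its first column. *)
Lemma det_first_column n (G : 'I_n -> nat -> R) : exists2 C, 0 <= C &
  forall (F : 'I_n -> nat -> R) e, 0 <= e ->
    (forall i j, (0 < j)%N -> F i j = G i j) ->
    (forall i, `|F i 0%N - G i 0%N| <= e) ->
    `|\det (\matrix_(i, j < n) F i j) - \det (\matrix_(i, j < n) G i j)| <= C * e.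
Proof.
case: n G => [|n] G.
  by exists 0 => // F e e0 _ _; rewrite !det_mx00 subrr normr0 mul0r.
pose cof i := cofactor (\matrix_(i, j < n.+1) G i j) i ord0.
exists (\sum_i `|cof i|); first exact: sumr_ge0.
move=> F e e0 FG F0; rewrite !(expand_det_col _ ord0) -sumrB.
have cofE i : cofactor (\matrix_(i, j < n.+1) F i j) i ord0 = cof i.
  rewrite /cof /cofactor; congr (_ * \det _); apply/matrixP => k j; rewrite !mxE.
  by apply: FG; rewrite lift0.
apply: le_trans (ler_norm_sum _ _ _) _; rewrite big_distrl /=; apply: ler_sum => i _.
by rewrite cofE !mxE -mulrBl normrM mulrC ler_wpM2l.
Qed.

End Exhaustion.

(** * Pieri rule for a row factor *)

Section PieriRow.
Variables (R : realType) (p q : R).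
Hypotheses (p0 : 0 < p) (pq : p < q) (q1 : q < 1).

Let p1 : p < 1. Proof. exact: lt_trans q1. Qed.

(** Coefficients of the power series of (1 - p z) / (1 - q z), nonnegative for
p <= q. *)
Definition row_coef (r : nat) : R := if r is r'.+1 then (q - p) * q ^+ r' else 1.

Lemma row_coef_ge0 r : 0 <= row_coef r.
Proof.
case: r => [|r] //=; rewrite mulr_ge0 ?subr_ge0 ?(ltW pq) // exprn_ge0 //.
exact: ltW (lt_trans p0 pq).
Qed.

Lemma row_coef_sum z d : (1 - q * z) * (\sum_(r < d.+1) row_coef r * z ^+ r) =
  (1 - p * z) - (q - p) * q ^+ d * z ^+ d.+1.
Proof.
elim: d => [|d IH]; first by rewrite big_ord1 /= !expr0 expr1; ring.
by rewrite big_ord_recr mulrDr IH /= !exprS; ring.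
Qed.

(** Contribution of the j-th part to the Pieri coefficient; it vanishes unless the
new part lies between the old one and the old preceding one, so that the skew
shape is a horizontal strip. *)
Definition row_weight n (la : intpart n) (j k : nat) : R :=
  if (part la j <= k)%N && ((j == 0%N) || (k <= part la j.-1)%N)
  then row_coef (k - part la j) else 0.

Lemma row_weight_ge0 n (la : intpart n) j k : 0 <= row_weight la j k.
Proof. by rewrite /row_weight; case: ifP => // _; exact: row_coef_ge0. Qed.

Definition row_factor z : R := (1 - p * z) / (1 - q * z).

Lemma row_denom z : 0 <= z <= 1 -> 1 - q <= 1 - q * z.
Proof.
by move=> /andP[z0 z1]; rewrite lerD2l lerN2 ler_piMr // (ltW (lt_trans p0 pq)).
Qed.

Lemma row_denom_neq0 z : 0 <= z <= 1 -> 1 - q * z != 0.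
Proof. by move=> /row_denom h; rewrite gt_eqF // (lt_le_trans _ h) // subr_gt0. Qed.

Lemma row_factor_ge0 z : 0 <= z <= 1 -> 0 <= row_factor z.
Proof.
move=> z01; rewrite divr_ge0 //.
  by have /andP[h _] := weight_itv p0 z01; apply: le_trans h; rewrite subr_ge0 ltW.
by apply: le_trans (row_denom z01); rewrite subr_ge0 ltW.
Qed.

(** Column functions of the alternant; they satisfy
z^(d+1) column_fun l j = (1 - p z) column_fun (l + d) (j - 1). *)
Definition column_fun n (l j : nat) (z : R) := z ^+ (l + (n - j.+1)) * (1 - p * z) ^+ j.

(** The power series of the factor, applied to the j-th column, continues after
degree d as a multiple of the factor applied to the preceding column.
Subtracting that multiple truncates the series at the horizontal strip
condition. *)
Lemma row_column_next n (la : intpart n) j B z : 0 <= z <= 1 ->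
  (0 < j)%N -> (j < n)%N -> (part la 0 < B)%N ->
  \sum_(r < B) row_weight la j r * column_fun n r j z =
  row_factor z * column_fun n (part la j) j z -
  (q - p) * q ^+ (part la j.-1 - part la j) *
    (row_factor z * column_fun n (part la j.-1) j.-1 z).
Proof.
move=> z01 j0 jn laB; have dn := row_denom_neq0 z01.
have le : (part la j <= part la j.-1)%N by apply: part_sorted; exact: leq_pred.
have ltB : (part la j.-1 < B)%N by exact: leq_ltn_trans (part_sorted _ _) laB.
rewrite /row_weight (gtn_eqF j0) /=.
under eq_bigr => r _ do rewrite (fun_if (fun w => w * _)) mul0r.
rewrite (sum_window (fun r => row_coef (r - part la j) * column_fun n r j z) le ltB).
set d := (part la j.-1 - part la j)%N; set l := part la j.
have -> : part la j.-1 = (d + l)%N by rewrite subnK.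
under eq_bigr => r _ do rewrite addKn.
apply: (mulfI dn); rewrite /row_factor.
pose u := z ^+ (l + (n - j.+1)) * (1 - p * z) ^+ j.
transitivity (((1 - q * z) * \sum_(r < d.+1) row_coef r * z ^+ r) * u).
  rewrite -mulrA; congr (_ * _); rewrite big_distrl /=; apply: eq_bigr => r _.
  by rewrite /column_fun /u [(l + r)%N]addnC -addnA exprD; ring.
rewrite row_coef_sum /column_fun.
have -> : (d + l + (n - j.-1.+1) = d.+1 + (l + (n - j.+1)))%N.
  by rewrite prednK //; lia.
rewrite /u; move: (l + (n - j.+1))%N => m; rewrite (exprD z d.+1 m).
case: (j) j0 => // i _ /=; rewrite (exprS (1 - p * z) i).
by field.
Qed.

Lemma row_column_first n (la : intpart n) D z : 0 <= z <= 1 -> (0 < n)%N ->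
  \sum_(r < (part la 0 + D).+1) row_weight la 0 r * column_fun n r 0 z =
  row_factor z * column_fun n (part la 0) 0 z -
  (q - p) * q ^+ D * z ^+ D.+1 * z ^+ (part la 0 + n.-1) / (1 - q * z).
Proof.
move=> z01 n0; have dn := row_denom_neq0 z01.
have laB : (part la 0 + D < (part la 0 + D).+1)%N by [].
rewrite (eq_bigr (fun r : 'I_(part la 0 + D).+1 =>
  if (part la 0 <= r <= part la 0 + D)%N then row_coef (r - part la 0) * column_fun n r 0 z else 0)); last first.
  move=> r _; rewrite /row_weight /= andbT -[(r <= _ + D)%N]ltnS ltn_ord andbT.
  by case: ifP => // _; rewrite mul0r.
rewrite (sum_window (fun r => row_coef (r - part la 0) * column_fun n r 0 z) (leq_addr _ _) laB).
rewrite addKn; under eq_bigr => r _ do rewrite addKn.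
apply: (mulfI dn); rewrite /row_factor.
set l := part la 0; pose u := z ^+ (l + (n - 1)).
transitivity (((1 - q * z) * \sum_(r < D.+1) row_coef r * z ^+ r) * u).
  rewrite -mulrA; congr (_ * _); rewrite big_distrl /=; apply: eq_bigr => r _.
  by rewrite /column_fun /u expr0 mulr1 [(l + r)%N]addnC -addnA exprD; ring.
rewrite row_coef_sum /column_fun /u subn1 expr0 mulr1.
by field.
Qed.

Lemma expr_small e : 0 < e -> exists D0, forall D, (D0 <= D)%N -> q ^+ D <= e.
Proof.
move=> e0; have q0 : 0 < q by exact: lt_trans p0 pq.
have : (GRing.exp q : R ^nat) @ \oo --> (0 : R).
  by apply: cvg_expr; rewrite gtr0_norm.
move=> /cvgrPdist_le/(_ e e0)[N _ hN]; exists N => D ND.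
by have := hN D ND; rewrite /= sub0r normrN ger0_norm // exprn_ge0 // ltW.
Qed.

(** All columns but the first are truncated by [row_column_next]. In the first
column the series is infinite; its partial sums are the sums over partitions
with bounded largest part, and their error decays like q^D. *)
Lemma row_pieri n (la : intpart n) (x : 'I_n -> R) :
  (forall i, 0 <= x i <= 1) -> vandermonde x != 0 ->
  has_sum (fun nu => (\prod_(j < n) row_weight la j (part nu j)) * geval p nu x)
    ((\prod_(i < n) row_factor (x i)) * geval p la x).
Proof.
move=> x01 vx; apply: has_sum_parts => [nu|e e0].
  rewrite mulr_ge0 ?geval_ge0 //; apply: prodr_ge0 => j _; exact: row_weight_ge0.
pose F' (i : 'I_n) j := row_factor (x i) * column_fun n (part la j) j (x i).
pose G (i : 'I_n) j := F' i j - (if (0 < j)%N then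
   (q - p) * q ^+ (part la j.-1 - part la j) * F' i j.-1 else 0).
pose F B (i : 'I_n) j := if (j < n)%N then
  \sum_(r < B) row_weight la j r * column_fun n r j (x i) else G i j.
have detG : \det (\matrix_(i, j < n) G i j) = (\prod_(i < n) row_factor (x i)) * alternant p x (part la).
  rewrite (det_colop_prev F' (fun j => (q - p) * q ^+ (part la j.-1 - part la j))).
  have -> : \prod_(i < n) row_factor (x i) = \det (diag_mx (\row_(i < n) row_factor (x i))).
    by rewrite det_diag; apply: eq_bigr => i _; rewrite mxE.
  rewrite -det_mulmx; congr (\det _); apply/matrixP => i j.
  by rewrite mul_diag_mx !mxE.
have detF B : \det (\matrix_(i, j < n) F B i j) =
    vandermonde x * \sum_(nu <- parts n B) (\prod_(j < n) row_weight la j (part nu j)) * geval p nu x.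
  have -> : \det (\matrix_(i, j < n) F B i j) = \det (\matrix_(i, j < n) \sum_(r < B)
     row_weight la j r * (x i ^+ (r + (n - j.+1)) * (1 - p * x i) ^+ j)).
    by congr (\det _); apply/matrixP => i j; rewrite !mxE /F ltn_ord.
  rewrite alternant_expand; last first.
    move=> j k l jn; rewrite /row_weight /=.
    case: ifP => [/andP[jk _] _|]; last by rewrite eqxx.
    case: ifP => [/andP[_ lj] _|]; last by rewrite eqxx.
    exact: leq_trans lj jk.
  by rewrite big_distrr /=; apply: eq_bigr => nu _; rewrite mulrCA vandermonde_geval.
have [C C0 hC] := det_first_column G.
have q1' : 0 < 1 - q by rewrite subr_gt0.
have nv : 0 < `|vandermonde x| by rewrite normr_gt0.
pose K := C * ((q - p) / (1 - q)) / `|vandermonde x| + 1.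
have K0 : 0 < K.
  rewrite ltr_wpDl // divr_ge0 // mulr_ge0 // divr_ge0 ?(ltW q1') // subr_ge0 ltW //.
have [D0 hD] := expr_small (divr_gt0 e0 K0).
exists (part la 0 + D0).+1 => B leB.
have [D DE BE] : exists2 D, (D0 <= D)%N & B = (part la 0 + D).+1.
  exists (B - (part la 0).+1)%N; lia.
have /ler_wpM2r : 0 <= `|vandermonde x|^-1 by rewrite invr_ge0 ltW.
set S := \sum_(nu <- _) _; set L := _ * geval p la x => mono.
have SL : S - L = (\det (\matrix_(i, j < n) F B i j) - \det (\matrix_(i, j < n) G i j)) / vandermonde x.
  by rewrite detF detG -vandermonde_geval -/S /L; field.
have bound : `|\det (\matrix_(i, j < n) F B i j) - \det (\matrix_(i, j < n) G i j)| <=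
    C * ((q - p) / (1 - q) * q ^+ D).
  apply: hC => [|i j j0|i].
  - rewrite mulr_ge0 ?exprn_ge0 ?(ltW (lt_trans p0 pq)) // divr_ge0 ?(ltW q1') //.
    by rewrite subr_ge0 ltW.
  - rewrite /F /G /F' j0; case: ifP => // jn.
    by rewrite (row_column_next (x01 i)) // BE ltnS leq_addr.
  - have n0 : (0 < n)%N by exact: leq_ltn_trans (ltn_ord i).
    rewrite /F /G /F' n0 BE (row_column_first _ _ (x01 i)) //= subr0.
    set a := row_factor _ * _; set b := _ / (1 - q * x i).
    have -> : a - b - a = - b by ring.
    have /andP[xi0 xi1] := x01 i.
    have q0 : 0 <= q by rewrite ltW // (lt_trans p0).
    have qp : 0 <= q - p by rewrite subr_ge0 ltW.
    have den := row_denom (x01 i).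
    have den0 : 0 < 1 - q * x i by exact: lt_le_trans den.
    have -> : b = ((q - p) * q ^+ D) *
      (x i ^+ D.+1 * x i ^+ (part la 0 + n.-1) * (1 - q * x i)^-1) by rewrite /b; ring.
    rewrite normrN ger0_norm; last first.
      by rewrite !mulr_ge0 ?exprn_ge0 // invr_ge0 ltW.
    rewrite [leRHS]mulrAC; apply: ler_pM; rewrite ?mulr_ge0 ?exprn_ge0 ?invr_ge0 ?(ltW den0) //.
    rewrite -[leRHS]mul1r; apply: ler_pM; rewrite ?mulr_ge0 ?exprn_ge0 ?invr_ge0 ?(ltW den0) //.
      by rewrite -exprD exprn_ile1.
    by rewrite lef_pV2 ?posrE.
rewrite SL normrM normfV; apply: le_trans (mono _ _ bound) _.
apply: (@le_trans _ _ (K * q ^+ D)).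
  rewrite /K [leRHS]mulrDl mul1r -[leLHS]addr0; apply: lerD; last first.
    by rewrite exprn_ge0 // ltW // (lt_trans p0).
  by rewrite le_eqVlt; apply/orP; left; apply/eqP; ring.
by rewrite mulrC -ler_pdivlMr // hD.
Qed.

End PieriRow.

(** * Pieri rule for a column factor *)

Section PieriColumn.
Variables (R : realType) (p : R).
Hypotheses (p0 : 0 < p) (p1 : p < 1).

Definition raised n (la : intpart n) (m : {ffun 'I_n -> bool}) (j : 'I_n) : nat :=
  (part la j + m j)%N.

(** Alternant whose j-th exponent is raised by one where m holds; the exponents
need not be decreasing. It is transposed with respect to [alternant], so that
columns of functions become rows. *)
Definition raised_alternant n (la : intpart n) (x : 'I_n -> R) (m : {ffun 'I_n -> bool}) : R :=
  \det (\matrix_(j, i < n) (x i ^+ (raised la m j + (n - j.+1)) * (1 - p * x i) ^+ j)).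

(** Let f be the j-th column function and g the raised k-th one, where k = j + 1.
For equal parts g = (1 - p z) f, hence f = g + p z f; replacing f by g gives
two equal columns, and z f is the raised j-th one. *)
Lemma raised_alternant_fill n (la : intpart n) (m : {ffun 'I_n -> bool}) (j k : 'I_n) x :
  val k = j.+1 -> m k -> ~~ m j -> part la j = part la k ->
  raised_alternant la x m = p * raised_alternant la x [ffun i => (i == j) || m i].
Proof.
move=> kj mk mj lajk; have jk : j != k by rewrite -val_eqE kj ltn_eqF.
set m' := [ffun i => _].
pose A m := \matrix_(j, i < n) (x i ^+ (raised la m j + (n - j.+1)) * (1 - p * x i) ^+ j).
pose B : 'M[R]_n := \matrix_(l, i) (A m (if l == j then k else l) i).
rewrite /raised_alternant -/(A m) -/(A m').
rewrite (@determinant_multilinear _ _ (A m) B (A m') j 1 p).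
- rewrite mul1r [\det B](@determinant_alternate _ _ _ j k jk) ?add0r //.
  by move=> i; rewrite /B !mxE eqxx if_same.
- apply/rowP => i; rewrite !mxE eqxx /raised ffunE eqxx (negPf mj) mk lajk.
  have kj' : k = j.+1 :> nat by [].
  have kn : (j.+1 < n)%N by rewrite -kj'.
  have -> : (n - j.+1 = (n - j.+2).+1)%N by lia.
  by rewrite kj' addn0 addn1 !addSn addnS !exprS; ring.
- apply/matrixP => l i; rewrite !mxE.
  by rewrite eq_sym (negPf (neq_lift _ _)).
- apply/matrixP => l i; rewrite !mxE /raised ffunE.
  by rewrite [_ == j]eq_sym (negPf (neq_lift _ _)).
Qed.

(** Whenever the raised exponents fail to be decreasing, [raised_alternant_fill]
raises one more, at the cost of a factor p. *)
Lemma raised_alternant_sorted n (la : intpart n) (m : {ffun 'I_n -> bool}) :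
  exists (nu : intpart n) k, (part nu 0 <= (part la 0).+1)%N /\
    forall x, raised_alternant la x m = p ^+ k * alternant p x (part nu).
Proof.
move: {2}#|[pred j | ~~ m j]| (erefl #|[pred j | ~~ m j]|) => N.
elim/ltn_ind: N m => N IH m mN.
have [/existsP[j /existsP[k /and3P[/eqP kj jk lt]]]|sorted] :=
  boolP [exists j : 'I_n, exists k : 'I_n,
    [&& val k == j.+1, m k && ~~ m j & part la j == part la k]].
  have /andP[mk mj] := jk.
  have [|nu [d [nu0 nuE]]] := IH #|[pred i | ~~ [ffun i => (i == j) || m i] i]| _ [ffun i => (i == j) || m i] erefl.
    rewrite -mN; apply/proper_card/properP; split.
      by apply/fintype.subsetP => i; rewrite !inE ffunE negb_or => /andP[].
    by exists j; rewrite !inE // ffunE eqxx.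
  exists nu, d.+1; split=> // x.
  by rewrite (raised_alternant_fill x kj mk mj (eqP lt)) nuE exprS mulrA.
pose f i := if insub i is Some j then raised la m j else 0%N.
have fE (i : 'I_n) : f i = raised la m i by rewrite /f valK.
have [|nu nuE] := @intpart_of_fun n f.
  move=> i lt; have i_n := ltnW lt.
  rewrite -[i]/(val (Ordinal i_n)) -[_.+1]/(val (Ordinal lt)) !fE /raised.
  have := part_sorted la (leqnSn i); rewrite leq_eqVlt => /orP[/eqP e|le]; last first.
    by rewrite /=; case: (m _); case: (m _); lia.
  rewrite [part la (Ordinal lt)]e leq_add2l.
  case mlt: (m (Ordinal lt)); case mi: (m (Ordinal i_n)) => //.
  move: sorted; rewrite negb_exists => /forallP/(_ (Ordinal i_n)).
  rewrite negb_exists => /forallP/(_ (Ordinal lt)).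
  by rewrite mlt mi e /= !eqxx.
exists nu, 0%N; split.
  case: n la m mN IH sorted f fE nu nuE => [|n] la m _ _ _ f fE nu nuE.
    by rewrite part_out.
  by rewrite (nuE ord0) fE /raised -(addn1 (part la 0)) leq_add2l leq_b1.
move=> x; rewrite mul1r /raised_alternant /alternant -det_tr; congr (\det _).
by apply/matrixP => i j; rewrite !mxE nuE fE.
Qed.

(** Expand every column of the alternant multiplied by a + b x_i into its two
terms and straighten each of the 2^n determinants. The coefficients stay
nonnegative because straightening only produces powers of p. *)
Lemma column_pieri (a b : R) n (la : intpart n) : 0 <= a -> 0 <= b ->
  exists K : intpart n -> R,
  [/\ forall nu, 0 <= K nu, forall nu, K nu != 0 -> (part nu 0 <= (part la 0).+1)%N &
   forall x : 'I_n -> R, (forall i, 0 <= x i <= 1) -> vandermonde x != 0 ->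
  has_sum (fun nu => K nu * geval p nu x)
    ((\prod_(i < n) (a + b * x i)) * geval p la x)].
Proof.
move=> a0 b0.
pose T := {ffun 'I_n -> bool}.
pose w (m : T) := \prod_(j < n) (if m j then b else a).
have w0 m : 0 <= w m by apply: prodr_ge0 => j _; case: ifP.
pose nu m := sval (cid (raised_alternant_sorted la m)).
have H1 m := svalP (cid (raised_alternant_sorted la m)).
pose k m := sval (cid (H1 m)).
have H2 m := svalP (cid (H1 m)).
pose K mu := \sum_(m | nu m == mu) w m * p ^+ k m.
have K0 mu : 0 <= K mu.
  by apply: sumr_ge0 => m _; rewrite mulr_ge0 // exprn_ge0 // ltW.
have Ksupp mu : K mu != 0 -> exists m, nu m = mu.
  apply: contra_neqP => h; rewrite /K big1 // => m /eqP e.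
  by case: h; exists m.
exists K; split=> // [mu /Ksupp[m <-]|x x01 vx]; first by case: (H2 m).
pose s := undup [seq nu m | m <- index_enum T].
suff -> : (\prod_(i < n) (a + b * x i)) * geval p la x = \sum_(mu <- s) K mu * geval p mu x.
  apply: has_sum_seq => [||mu]; first exact: undup_uniq.
    by move=> mu; rewrite mulr_ge0 // geval_ge0.
  rewrite mem_undup => /negP h; apply/eqP; rewrite mulf_eq0; apply/orP; left.
  by apply/negPn/negP => /Ksupp[m e]; apply: h; rewrite -e map_f // mem_index_enum.
apply: (mulfI vx); rewrite mulrCA vandermonde_geval.
have -> : (\prod_(i < n) (a + b * x i)) * alternant p x (part la) = \sum_(m : T) w m * raised_alternant la x m.
  have -> : \prod_(i < n) (a + b * x i) = \det (diag_mx (\row_(i < n) (a + b * x i))).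
    by rewrite det_diag; apply: eq_bigr => i _; rewrite mxE.
  rewrite -det_mulmx.
  transitivity (\det (\matrix_(i, j < n) \sum_(r : bool) ((if r then b else a) *
     (x i ^+ (part la j + r + (n - j.+1)) * (1 - p * x i) ^+ j)))).
    congr (\det _); apply/matrixP => i j; rewrite mul_diag_mx !mxE big_bool /=.
    by rewrite addn0 addn1 addSn exprS; ring.
  rewrite (det_sum_cols (fun i j (r : bool) => (if r then b else a) *
     (x i ^+ (part la j + r + (n - j.+1)) * (1 - p * x i) ^+ j))).
  apply: eq_bigr => m _.
  have -> : w m = \det (diag_mx (\row_(j < n) (if m j then b else a))).
    by rewrite det_diag; apply: eq_bigr => j _; rewrite mxE.
  rewrite -det_mulmx -det_tr; congr (\det _); apply/matrixP => j i.
  by rewrite mul_diag_mx !mxE.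
rewrite big_distrr /=.
have nus m : nu m \in s by rewrite mem_undup map_f // mem_index_enum.
under [RHS]eq_bigr => mu _ do rewrite mulrCA vandermonde_geval /K big_distrl /= big_mkcond /=.
rewrite exchange_big /=; apply: eq_bigr => m _.
rewrite (bigD1_seq (nu m)) ?undup_uniq //= eqxx big1 ?addr0; last first.
  by move=> mu /negPf h; rewrite eq_sym h.
by have [_ ->] := H2 m; rewrite mulrA.
Qed.

End PieriColumn.

(** * Positive expansions and their extension to the cube *)

Section Existence.
Variables (R : realType) (p : R).
Hypotheses (p0 : 0 < p) (p1 : p < 1).

(** The points with vanishing Vandermonde determinant, such as 1^n for n > 1, are
excluded here: they are reached only by [expands_cube]. *)
Definition expands n (c : intpart n -> R) (phi : R -> R) : Prop :=
  (forall la, 0 <= c la) /\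
  forall x : 'I_n -> R, (forall i, 0 <= x i <= 1) -> vandermonde x != 0 ->
    has_sum (fun la => c la * geval p la x) (\prod_(i < n) phi (x i)).

Lemma expands_one n : exists c : intpart n -> R, expands c (fun=> 1) /\
  forall la, c la != 0 -> part la 0 = 0%N.
Proof.
have [|o oE] := @intpart_of_fun n (fun=> 0%N); first by [].
have o0 i : part o i = 0%N.
  by have [ni|ni] := ltnP i n; [exact: (oE (Ordinal ni))|rewrite part_out].
exists (fun la => (la == o)%:R); split; last first.
  by move=> la; have [->//|_] := eqVneq la o; rewrite eqxx.
split=> [la|x x01 vx]; first exact: ler0n.
rewrite big1 //.
have s1 : \sum_(la <- [:: o]) (la == o)%:R * geval p la x = 1.
  by rewrite big_seq1 eqxx mul1r geval_empty.
rewrite -[X in has_sum _ X]s1.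
apply: (@has_sum_seq _ _ (fun la => (la == o)%:R * geval p la x)) => // la.
  by rewrite mulr_ge0 // geval_ge0.
by rewrite inE => /negPf->; rewrite mul0r.
Qed.

(** The new coefficients are the sums of c la * P la nu over la. They are finite
because the value of G_nu at the grid point is positive. *)
Lemma expands_step n (c : intpart n -> R) (P : intpart n -> intpart n -> R) phi psi :
  (forall la nu, 0 <= P la nu) -> (forall z, 0 <= z <= 1 -> 0 <= psi z) ->
  (forall la (x : 'I_n -> R), (forall i, 0 <= x i <= 1) -> vandermonde x != 0 ->
    has_sum (fun nu => P la nu * geval p nu x) ((\prod_(i < n) psi (x i)) * geval p la x)) ->
  expands c phi ->
  exists c', expands c' (fun z => psi z * phi z) /\
    forall nu, c' nu != 0 -> exists la, c la != 0 /\ P la nu != 0.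
Proof.
move=> P0 psi0 hP [c0 hc].
have sums (x : 'I_n -> R) : (forall i, 0 <= x i <= 1) -> vandermonde x != 0 ->
  exists2 C : intpart n -> R,
    (forall nu, has_sum (fun la => c la * (P la nu * geval p nu x)) (C nu)) &
    has_sum C (\prod_(i < n) (psi (x i) * phi (x i))).
  move=> x01 vx.
  apply: (@has_sum_fubini _ _ _ (fun la nu => c la * (P la nu * geval p nu x))
    (fun la => c la * ((\prod_(i < n) psi (x i)) * geval p la x))).
    by move=> la; apply: has_sumZ => //; exact: hP.
  rewrite big_split /=.
  have pp : 0 <= \prod_(i < n) psi (x i) by apply: prodr_ge0 => i _; exact: psi0.
  by apply: eq_has_sum (has_sumZ pp (hc x x01 vx)) => la; rewrite mulrCA.
have g01 i := @grid_itv R n i.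
have [C0 hC0 _] := sums (@grid R n) g01 (vandermonde_grid R n).
have gp nu : 0 < geval p nu (@grid R n).
  apply: geval_gt0 => // i; have /andP[_ ->] := g01 i.
  by rewrite andbT divr_gt0 ?ltr0n.
(* at the grid point the factor geval p nu can be divided out *)
pose c' nu := C0 nu / geval p nu (@grid R n).
have hc' nu : has_sum (fun la => c la * P la nu) (c' nu).
  have ge : 0 <= (geval p nu (@grid R n))^-1 by rewrite invr_ge0 ltW.
  have := has_sumZ ge (hC0 nu); rewrite mulrC; apply: eq_has_sum => la.
  by rewrite mulrC -mulrA -mulrA divff ?mulr1 // gt_eqF.
exists c'; split.
  split=> [nu|x x01 vx]; first exact: has_sum_ge0 (hc' nu).
  have [C hC CE] := sums x x01 vx; apply: eq_has_sum CE => nu.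
  have ge := geval_ge0 p0 p1 nu x01.
  apply: has_sum_uniq (hC nu) _; rewrite mulrC.
  by apply: eq_has_sum (has_sumZ ge (hc' nu)) => la; rewrite mulrC mulrA.
move=> nu; apply: contra_neqP => h.
apply: has_sum_uniq (hc' nu) _.
have -> : 0 = \sum_(la <- [::]) c la * P la nu by rewrite big_nil.
apply: (@has_sum_seq _ _ (fun la => c la * P la nu)) => [//|la|la _]; first by rewrite mulr_ge0.
apply/eqP/negPn; rewrite mulf_eq0 negb_or; apply/negP => /andP[h1 h2].
by apply: h; exists la.
Qed.

Lemma line_poly_cvg n (F : ('I_n -> R) -> R) x : line_poly F ->
  (fun e => F (segment x (@grid R n) e)) @ 0^'+ --> F x.
Proof.
move=> hF; have [q qE] := hF x (@grid R n).
have -> : F x = q.[0].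
  by rewrite -qE; congr F; apply/funext => i; rewrite /segment mul0r addr0.
have -> : (fun e => F (segment x (@grid R n) e)) = horner q by apply/funext.
by apply: cvg_at_right_filter; exact: continuous_horner.
Qed.

Lemma near_vandermonde n (x : 'I_n -> R) :
  \forall e \near 0^'+, vandermonde (segment x (@grid R n) e) != 0.
Proof.
have [w wE] := line_poly_vandermonde x (@grid R n).
have w0 : w != 0.
  apply: contraNneq (vandermonde_grid R n) => w0.
  have := wE 1; rewrite w0 horner0 => e1; apply/eqP; rewrite -[RHS]e1.
  by congr (vandermonde _); apply/funext => i; rewrite /segment mul1r addrC subrK.
have [k [r rn0 wr]] := multiplicity_XsubC w 0.
have r0 : r.[0] != 0 by move: rn0; rewrite w0.
have rnz : \forall e \near 0^'+, r.[e] != 0.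
  apply: (@cvgr_neq0 _ _ _ _ _ (horner r) r.[0]) => //.
  by apply: cvg_at_right_filter; exact: continuous_horner.
near=> e; rewrite wE wr subr0 hornerM hornerXn mulf_neq0 //; first by near: e.
by rewrite expf_neq0 // gt_eqF.
Unshelve. all: by end_near.
Qed.

Lemma cvg_prod_seq (I : Type) (r : seq I) (f : I -> R -> R) (l : I -> R)
    (F : set_system R) {FF : Filter F} :
  (forall i, f i @ F --> l i) ->
  (fun e => \prod_(i <- r) f i e) @ F --> \prod_(i <- r) l i.
Proof.
move=> fl; elim: r => [|i r IH].
  rewrite big_nil; under eq_fun do rewrite big_nil; exact: cvg_cst.
by rewrite big_cons; under eq_fun do rewrite big_cons; exact: cvgM.
Qed.

Lemma segment_itv n (x : 'I_n -> R) e i : 0 <= e <= 1 ->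
  (forall i, 0 <= x i <= 1) -> 0 <= segment x (@grid R n) e i <= 1.
Proof. by move=> e01 x01; have := x01 i; have := grid_itv R i; rewrite /segment; nra. Qed.

Lemma has_sum_restrict (T : choiceType) (f : T -> R) (s : seq T) : uniq s ->
  (forall x, 0 <= f x) ->
  has_sum (fun x => if x \in s then f x else 0) (\sum_(x <- s) f x).
Proof.
move=> us f0; rewrite (eq_big_seq (fun x => if x \in s then f x else 0)); last by move=> x ->.
by apply: (has_sum_seq us) => x; [case: ifP|move=> /negPf->].
Qed.

Lemma has_sum_tail_dom (T : choiceType) (f h : T -> R) l H c (s : seq T) : uniq s ->
  has_sum f l -> has_sum h H -> 0 <= c ->
  (forall x, f x <= c * h x) -> l - \sum_(x <- s) f x <= c * (H - \sum_(x <- s) h x).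
Proof.
move=> us fl hH c0 fh.
have h1 := has_sumD fl (has_sumZ c0 (has_sum_restrict us hH.1)).
have h2 := has_sumD (has_sum_restrict us fl.1) (has_sumZ c0 hH).
rewrite lerBlDl mulrBr addrA lerBrDr; apply: has_sum_le h1 h2 => x /=.
by case: ifP => // _; rewrite mulr0 addr0 add0r.
Qed.

(** Approach x along the segment to the grid point. Finite partial sums pass to
the limit, which bounds all of them at 1^n; thus the masses c la * geval1 la are
summable. By [geval_le] they dominate the terms at every point of the cube
uniformly, and so the sums converge too. *)
Lemma expands_cube n (c : intpart n -> R) phi :
  expands c phi -> (forall z, 0 <= z <= 1 -> {for z, continuous phi}) -> phi 1 = 1 ->
  cube_gf p (fun la => c la * geval1 p la) phi.
Proof.
move=> [c0 hc] phic phi1.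
have g1 la := geval1_gt0 p0 p1 la.
have phi_cvg x : (forall i, 0 <= x i <= 1) ->
    (fun e => \prod_(i < n) phi (segment x (@grid R n) e i)) @ 0^'+ -->
    \prod_(i < n) phi (x i).
  move=> x01.
  apply: (@cvg_prod_seq _ _ (fun i e => phi (segment x (@grid R n) e i)) (fun i => phi (x i))) => i.
  apply: (@cvg_comp _ _ _ (fun e => segment x (@grid R n) e i) phi _ (nbhs (x i))).
    exact: (line_poly_cvg (line_poly_var i)).
  exact: phic.
have sum_cvg x (s : seq (intpart n)) :
    (fun e => \sum_(la <- s) c la * geval p la (segment x (@grid R n) e)) @ 0^'+ -->
    \sum_(la <- s) c la * geval p la x.
  apply: (line_poly_cvg (F := fun y => \sum_(la <- s) c la * geval p la y)).
  apply: line_poly_sum => la; apply: line_polyM; first exact: line_poly_cst.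
  exact: line_poly_meval.
have near01 : \forall e \near (0 : R)^'+, 0 <= e <= 1.
  near=> e; apply/andP; split; first by rewrite ltW.
  by near: e; exact: nbhs_right_le.
have good x : (forall i, 0 <= x i <= 1) -> \forall e \near 0^'+,
    has_sum (fun la => c la * geval p la (segment x (@grid R n) e))
      (\prod_(i < n) phi (segment x (@grid R n) e i)).
  move=> x01; near=> e; apply: hc; last by near: e; exact: near_vandermonde.
  by move=> i; apply: segment_itv => //; near: e.
have upper x (s : seq (intpart n)) : (forall i, 0 <= x i <= 1) -> uniq s ->
    \sum_(la <- s) c la * geval p la x <= \prod_(i < n) phi (x i).
  move=> x01 us; apply: ler_cvg_to (sum_cvg x s) (phi_cvg x x01) _.
  by near=> e; apply: has_sum_ub us; near: e; exact: good.
pose M la := c la * geval1 p la.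
have M0 la : 0 <= M la by rewrite mulr_ge0 // ltW.
have [l1 Ml1 _] : exists2 l1, has_sum M l1 & l1 <= 1.
  apply: has_sum_bounded => // s us; apply: le_trans (upper (fun=> 1) s _ us) _.
    by move=> i; rewrite ler01 lexx.
  by rewrite phi1 big1.
have C0 : 0 < (1 - p) ^- (n * n) by rewrite invr_gt0 exprn_gt0 // subr_gt0.
move=> x x01; apply: (eq_has_sum (f := fun la => c la * geval p la x)).
  by move=> la; rewrite mulrA mulrAC mulfK // gt_eqF.
apply: has_sum_intro => [la|s us|e e0].
- by rewrite mulr_ge0 // geval_ge0.
- exact: upper.
have [s us /ltW ls] := has_sum_approx Ml1 (divr_gt0 e0 C0).
exists s => //.
have : \prod_(i < n) phi (x i) <= \sum_(la <- s) c la * geval p la x +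
    (1 - p) ^- (n * n) * (l1 - \sum_(la <- s) M la).
  apply: ler_cvg_to (phi_cvg x x01) (cvgD (sum_cvg x s) (cvg_cst _)) _.
  near=> t; rewrite -lerBlDl; apply: has_sum_tail_dom Ml1 _ _ => //.
  - by near: t; exact: good.
  - exact: ltW.
  move=> la; rewrite mulrCA ler_wpM2l //.
  have := @geval_le _ p p0 p1 n la (segment x (@grid R n) t) 1 (lexx 1).
  rewrite expr1n mulr1; apply=> i; apply: segment_itv => //; near: t; exact: near01.
have : (1 - p) ^- (n * n) * (l1 - \sum_(la <- s) M la) <= e.
  rewrite mulrC -ler_pdivlMr //; lra.
lra.
Unshelve. all: by end_near.
Qed.
End Existence.

(** * The measures attached to finite parameter sequences *)

Section Families.
Variables (R : realType) (p : R).
Hypotheses (p0 : 0 < p) (p1 : p < 1).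

Let p1' : 0 < 1 - p. Proof. by rewrite subr_gt0. Qed.

Definition row_psi (a z : R) := (1 - p / (1 - p) * (z - 1)) / (1 - a * (z - 1)).
Definition col_psi (b z : R) := 1 + (b - p) / (1 - p) * (z - 1).

Lemma Phi_row_cons a A z : Phi p (a :: A) [::] z = row_psi a z * Phi p A [::] z.
Proof. by rewrite /Phi !big_nil !mulr1 big_cons. Qed.

Lemma Phi_col_cons b B z : Phi p [::] (b :: B) z = col_psi b z * Phi p [::] B z.
Proof. by rewrite /Phi !big_nil !mul1r big_cons. Qed.

Lemma Phi_nil : Phi p [::] [::] = fun=> 1.
Proof. by apply/funext => z; rewrite /Phi !big_nil mulr1. Qed.

Section Row.
Variable a : R.
Hypothesis ha : p / (1 - p) < a.

Lemma row_param_gt0 : 0 < a.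
Proof. by apply: lt_trans ha; rewrite divr_gt0. Qed.

Let a1 : 0 < 1 + a. Proof. by have := row_param_gt0; lra. Qed.
Let q := a / (1 + a).
Let gam := ((1 - p) * (1 + a))^-1.

Lemma row_denominator_ge1 z : z <= 1 -> 1 <= (1 + a) + (- a) * z.
Proof. by have := row_param_gt0; nra. Qed.

Lemma row_psiE z : row_psi a z =
  (((1 - p)^-1 + (- (p / (1 - p))) * z) * 1) / ((1 + a) + (- a) * z).
Proof.
rewrite /row_psi; congr (_ / _); last by ring.
by field; rewrite gt_eqF.
Qed.

(** The parameter q = a / (1 + a) turns the geometric series in z - 1 into one in
z; the condition a > p / (1 - p) becomes q > p. *)
Lemma row_psi_factor z : 0 <= z <= 1 -> row_psi a z = gam * row_factor p q z.
Proof.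
move=> /andP[z0 z1]; rewrite row_psiE /row_factor /gam /q.
have h := row_denominator_ge1 z1.
by field; apply/and3P; split; rewrite gt_eqF //; lra.
Qed.

Lemma row_q : p < q /\ q < 1.
Proof.
have a0 := row_param_gt0; split; last by rewrite /q ltr_pdivrMr // mul1r; lra.
move: ha; rewrite ltr_pdivrMr // => h.
by rewrite /q ltr_pdivlMr //; nra.
Qed.

(** A horizontal strip adds at most one row. *)
Lemma expands_row_step n (c : intpart n -> R) k phi :
  expands p c phi -> (forall la, c la != 0 -> part la k = 0%N) ->
  exists c' : intpart n -> R, expands p c' (fun z => row_psi a z * phi z) /\
   forall la, c' la != 0 -> part la k.+1 = 0%N.
Proof.
move=> hc ck; have [pq q1] := row_q.
have gam0 : 0 <= gam by rewrite /gam invr_ge0 mulr_ge0 // ltW.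
pose P (la nu : intpart n) := gam ^+ n * \prod_(j < n) row_weight p q la j (part nu j).
have P0 la nu : 0 <= P la nu.
  rewrite /P mulr_ge0 ?exprn_ge0 //; apply: prodr_ge0 => j _; exact: row_weight_ge0.
have [||c' [hc' supp]] := expands_step p0 p1 P0 (psi := row_psi a) _ _ hc.
- move=> z z01; rewrite row_psi_factor // mulr_ge0 //; exact: row_factor_ge0.
- move=> la x x01 vx.
  have -> : \prod_(i < n) row_psi a (x i) = gam ^+ n * \prod_(i < n) row_factor p q (x i).
    under eq_bigr => i _ do rewrite row_psi_factor //.
    by rewrite big_split /= prodr_const card_ord.
  rewrite -mulrA; apply: eq_has_sum (has_sumZ (exprn_ge0 _ gam0) (row_pieri p0 pq q1 la x01 vx)) => nu.
  by rewrite mulrA.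
exists c'; split=> // nu /supp[la [/ck lak]].
rewrite /P mulf_eq0 negb_or => /andP[_ /prodf_neq0 nz].
have [kn|kn] := ltnP k.+1 n; last by rewrite part_out.
have := nz (Ordinal kn) isT; rewrite /row_weight /=; case: ifP => [/andP[_]|]; last by rewrite eqxx.
by rewrite lak leqn0 => /eqP.
Qed.

Lemma smooth_row_psi f D : smooth_data f D -> exists D', smooth_data (fun z => row_psi a z * f z) D'.
Proof.
move=> fD; exists (div_data (1 + a) (- a) (mul_data (1 - p)^-1 (- (p / (1 - p))) D)).
have := smooth_div ltr01 row_denominator_ge1 (smooth_mul (1 - p)^-1 (- (p / (1 - p))) fD).
congr (smooth_data _ _); apply/funext => z; rewrite row_psiE mulr1.
by rewrite mulrAC.
Qed.

Lemma row_psi_continuous z : 0 <= z <= 1 -> {for z, continuous (row_psi a)}.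
Proof.
move=> /andP[z0 z1]; have h := row_denominator_ge1 z1.
have -> : row_psi a = (fun y : R => (1 - p)^-1 + (- (p / (1 - p))) * y) * (fun y : R => ((1 + a) + (- a) * y)^-1).
  by apply/funext => y; rewrite row_psiE mulr1.
apply: differentiable_continuous; apply/derivable1_diffP; apply: derivableM.
  by case: (is_derive_affine (1 - p)^-1 (- (p / (1 - p))) z).
apply: derivableV; first by rewrite gt_eqF //; lra.
by case: (is_derive_affine (1 + a) (- a) z).
Qed.

Lemma row_psi1 : row_psi a 1 = 1.
Proof. by rewrite /row_psi subrr !mulr0 !subr0 divr1. Qed.
End Row.

Lemma expands_row n A : {in A, forall a, p / (1 - p) < a} ->
  exists c : intpart n -> R, expands p c (Phi p A [::]) /\
   forall la, c la != 0 -> part la (size A) = 0%N.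
Proof.
elim: A => [|a A IH] hA; first by rewrite Phi_nil; exact: expands_one.
have [|c [hc ck]] := IH; first by move=> b bA; apply: hA; rewrite inE bA orbT.
have ha : p / (1 - p) < a by apply: hA; rewrite inE eqxx.
have [c' [hc' ck']] := expands_row_step ha hc ck.
exists c'; split=> //; move: hc'; congr (expands p c' _).
by apply/funext => z; rewrite Phi_row_cons.
Qed.

Definition regular_gf (phi : R -> R) : Prop :=
  [/\ exists D, smooth_data phi D,
     forall z, 0 <= z <= 1 -> {for z, continuous phi} & phi 1 = 1].

Lemma regular_gf_row A : {in A, forall a, p / (1 - p) < a} -> regular_gf (Phi p A [::]).
Proof.
elim: A => [|a A IH] hA.
  rewrite Phi_nil; split=> //; first by exists (fun k _ => if k is 0%N then 1 else 0); exact: smooth_cst.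
  by move=> z _; exact: cst_continuous.
have [|[D fD] cA A1] := IH; first by move=> b bA; apply: hA; rewrite inE bA orbT.
have ha : p / (1 - p) < a by apply: hA; rewrite inE eqxx.
have -> : Phi p (a :: A) [::] = (fun z => row_psi a z * Phi p A [::] z).
  by apply/funext => z; rewrite Phi_row_cons.
split; first exact: smooth_row_psi fD.
  by move=> z z01; apply: cvgM; [exact: row_psi_continuous|exact: cA].
by rewrite row_psi1 A1 mulr1.
Qed.

Section Column.
Variable b : R.
Hypothesis hb : p <= b <= 1.

(** Both coefficients are nonnegative exactly when p <= b <= 1. *)
Lemma col_psiE z : col_psi b z = (1 - b) / (1 - p) + (b - p) / (1 - p) * z.
Proof. by rewrite /col_psi; field; rewrite gt_eqF. Qed.

Lemma expands_column_step n (c : intpart n -> R) k phi :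
  expands p c phi -> (forall la, c la != 0 -> (part la 0 <= k)%N) ->
  exists c' : intpart n -> R, expands p c' (fun z => col_psi b z * phi z) /\
   forall la, c' la != 0 -> (part la 0 <= k.+1)%N.
Proof.
move=> hc ck; have /andP[pb b1] := hb.
have a0' : 0 <= (1 - b) / (1 - p) by rewrite divr_ge0 ?subr_ge0 // ltW.
have b0' : 0 <= (b - p) / (1 - p) by rewrite divr_ge0 ?subr_ge0 // ltW.
pose P la := sval (cid (column_pieri p0 p1 (n := n) la a0' b0')).
have HP la := svalP (cid (column_pieri p0 p1 (n := n) la a0' b0')).
have P0 la nu : 0 <= P la nu by have [+ _ _] := HP la; apply.
have [||c' [hc' supp]] := expands_step p0 p1 P0 (psi := col_psi b) _ _ hc.
- by move=> z /andP[z0 z1]; rewrite col_psiE addr_ge0 // mulr_ge0.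
- move=> la x x01 vx; have [_ _ h] := HP la.
  by under eq_bigr => i _ do rewrite col_psiE; exact: h.
exists c'; split=> // nu /supp[la [/ck lak Pn]].
by have [_ h _] := HP la; apply: leq_trans (h nu Pn) _.
Qed.
End Column.

Lemma expands_column n B : {in B, forall b, p <= b <= 1} ->
  exists c : intpart n -> R, expands p c (Phi p [::] B) /\
   forall la, c la != 0 -> (part la 0 <= size B)%N.
Proof.
elim: B => [|b B IH] hB.
  rewrite Phi_nil; have [c [hc c0]] := expands_one p0 p1 n; exists c; split=> // la.
  by move=> /c0->.
have [|c [hc ck]] := IH; first by move=> d dB; apply: hB; rewrite inE dB orbT.
have hb : p <= b <= 1 by apply: hB; rewrite inE eqxx.
have [c' [hc' ck']] := expands_column_step hb hc ck.
exists c'; split=> //; move: hc'; congr (expands p c' _).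
by apply/funext => z; rewrite Phi_col_cons.
Qed.

Lemma regular_gf_column B : regular_gf (Phi p [::] B).
Proof.
elim: B => [|b B [[D fD] cB B1]].
  rewrite Phi_nil; split=> //; first by exists (fun k _ => if k is 0%N then 1 else 0); exact: smooth_cst.
  by move=> z _; exact: cst_continuous.
have psiE : col_psi b = (fun z => (1 - b) / (1 - p) + (b - p) / (1 - p) * z).
  by apply/funext => z; exact: col_psiE.
have -> : Phi p [::] (b :: B) = (fun z => col_psi b z * Phi p [::] B z).
  by apply/funext => z; rewrite Phi_col_cons.
split.
- by rewrite psiE; eexists; exact: smooth_mul fD.
- move=> z z01; have cpsi : {for z, continuous (col_psi b)}.
    rewrite psiE; apply: differentiable_continuous; apply/derivable1_diffP.
    by case: (is_derive_affine ((1 - b) / (1 - p)) ((b - p) / (1 - p)) z).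
  by apply: cvgM; [exact: cpsi|exact: cB].
by rewrite B1 mulr1 /col_psi subrr mulr0 addr0.
Qed.
End Families.

(** * Placing a point in blocks of variables *)

Section Blocks.
Variables (R : realType) (p : R).
Hypotheses (p0 : 0 < p) (p1 : p < 1).
Variables (r k : nat).
Hypothesis k0 : (0 < k)%N.

Let N := (r * k)%N.

Lemma blk_subproof (i : 'I_N) : (i %/ k < r)%N.
Proof. by rewrite ltn_divLR // ltn_ord. Qed.
Definition blk (i : 'I_N) : 'I_r := Ordinal (blk_subproof i).

Lemma off_subproof (i : 'I_N) : (i %% k < k)%N.
Proof. by rewrite ltn_mod. Qed.
Definition off (i : 'I_N) : 'I_k := Ordinal (off_subproof i).

Lemma unblk_subproof (s : 'I_r) (j : 'I_k) : (s * k + j < N)%N.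
Proof.
apply: (@leq_trans (s.+1 * k)%N); first by rewrite mulSn addnC ltn_add2r.
by rewrite leq_mul2r ltn_ord orbT.
Qed.
Definition unblk s j : 'I_N := Ordinal (unblk_subproof s j).

Lemma blk_unblk s j : blk (unblk s j) = s.
Proof. by apply/val_inj; rewrite /= divnMDl // divn_small // addn0. Qed.

Lemma off_unblk s j : off (unblk s j) = j.
Proof. by apply/val_inj; rewrite /= modnMDl modn_small. Qed.

Lemma unblkK i : unblk (blk i) (off i) = i.
Proof. by apply/val_inj; rewrite /= -divn_eq. Qed.

Definition place (x : 'I_k -> R) (S : pred 'I_r) (i : 'I_N) : R :=
  if S (blk i) then x (off i) else 1.

(** Permuting whole blocks permutes the variables. *)
Lemma geval_place_perm (la : intpart N) x (S : pred 'I_r) (s : 'S_r) :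
  (forall j, 0 <= x j <= 1) ->
  geval p la (place x (fun i => S (s i))) = geval p la (place x S).
Proof.
move=> x01; pose f i := unblk (s (blk i)) (off i).
have fi : injective f.
  move=> i j e; rewrite -[i]unblkK -[j]unblkK.
  have := congr1 blk e; rewrite /f !blk_unblk => /perm_inj ->.
  by have := congr1 off e; rewrite /f !off_unblk => ->.
have -> : place x (fun i => S (s i)) = place x S \o perm fi.
  by apply/funext => i; rewrite /place /= permE /f blk_unblk off_unblk.
apply: geval_perm => // i; rewrite /place; case: ifP => // _.
by rewrite ler01 lexx.
Qed.

Lemma card_blk s : (#|[pred i | blk i == s]| <= k)%N.
Proof.
rewrite -[leqRHS]card_ord -(@card_in_image _ _ off) ?max_card //.
move=> i j; rewrite !inE => /eqP bi /eqP bj e.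
by rewrite -[i]unblkK -[j]unblkK bi bj e.
Qed.
End Blocks.

Lemma perm_two r (u v s t : 'I_r) : u != v -> s != t ->
  exists w : 'S_r, w u = s /\ w v = t.
Proof.
move=> uv st; pose w1 := tperm u s; pose t' := w1 t.
have t'u : t' != u.
  by apply: contraNneq st => tu; rewrite -[t](tpermK u s) -/w1 -/t' tu /w1 tpermL.
exists (tperm v t' * w1)%g; rewrite !permM; split.
  have -> : tperm v t' u = u by rewrite tpermD // eq_sym.
  by rewrite /w1 tpermL.
by rewrite tpermL /t' tpermK.
Qed.

(** * The second moment inequality *)

Section SecondMoment.
Variables (R : realType) (p : R).
Hypotheses (p0 : 0 < p) (p1 : p < 1).

(** With respect to the probability measure of the chains ending in la, the mean
of (sum_s Y_s - r e)^2 is nonnegative, where Y_s collects the factors of the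
s-th block. Its expansion has r (r - 1) mixed terms, all equal to e2 by
symmetry, and r squares, each bounded through the exponents of 1 - p x. *)
Lemma second_moment r k K (la : intpart (r * k)) (x : 'I_k -> R)
    (k0 : (0 < k)%N) (u v : 'I_r) :
  u != v -> narrow K la -> (forall j, 0 <= x j <= 1) ->
  (geval p la (place k0 x (pred1 u)) / geval1 p la) ^+ 2 <=
  geval p la (place k0 x (pred2 u v)) / geval1 p la +
  (((1 - p) ^- K) ^+ k) ^+ 2 / r%:R.
Proof.
move=> uv bd x01.
have q0 : 0 < 1 - p by rewrite subr_gt0.
have [I [a [b [_ aE bE gE]]]] := tableaux p0 p1 la.
pose P t := \prod_i (1 - p) ^+ b t i.
(* relative weight of the i-th step, equal to 1 at z = 1 *)
pose h t i z := z ^+ a t i * ((1 - p * z) / (1 - p)) ^+ b t i.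
pose Y t s := \prod_(i | blk k0 i == s) h t i (x (off k0 i)).
have P0 t : 0 <= P t by apply: prodr_ge0 => i _; rewrite exprn_ge0 // ltW.
have place01 S i : 0 <= place k0 x S i <= 1.
  by rewrite /place; case: ifP => // _; rewrite ler01 lexx.
have gS S : geval p la (place k0 x S) = \sum_t P t * \prod_(s | S s) Y t s.
  rewrite gE //; apply: eq_bigr => t _.
  have -> : \prod_(s | S s) Y t s =
      \prod_i (if S (blk k0 i) then h t i (x (off k0 i)) else 1).
    rewrite [RHS](partition_big (blk k0) xpredT) //= big_mkcond /=.
    apply: eq_bigr => s _; rewrite /Y; case: ifP => Ss.
      by apply: eq_bigr => i /eqP ->; rewrite Ss.
    by rewrite big1 // => i /eqP ->; rewrite Ss.
  rewrite /P -big_split /=.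
  apply: eq_bigr => i _; rewrite /place /h.
  case: ifP => _; last by rewrite expr1n mul1r !mulr1.
  rewrite mulrCA; congr (_ * _).
  by rewrite -exprMn [(1 - p) * _]mulrC divfK // gt_eqF.
set e1 := geval p la (place k0 x (pred1 u)); set e2 := geval p la (place k0 x (pred2 u v)).
have g1 : geval1 p la = \sum_t P t.
  have := gS pred0; rewrite (_ : place k0 x pred0 = fun=> 1); last by apply/funext.
  by rewrite /geval1 => ->; apply: eq_bigr => t _; rewrite big_pred0 ?mulr1.
have E1 s : \sum_t P t * Y t s = e1.
  have -> : \sum_t P t * Y t s = \sum_t P t * \prod_(s' | pred1 s s') Y t s'.
    by apply: eq_bigr => t _; rewrite big_pred1_eq.
  rewrite -gS /e1 -(@geval_place_perm _ p r k k0 la x (pred1 s) (tperm u s) x01).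
  congr (geval p la _); apply/funext => i; rewrite /place /=.
  by rewrite -(inj_eq (@perm_inj _ (tperm u s))) tpermK tpermR.
have E2 s t : s != t -> \sum_y P y * (Y y s * Y y t) = e2.
  move=> st; have [w [wu wv]] := perm_two uv st.
  have -> : \sum_y P y * (Y y s * Y y t) = \sum_y P y * \prod_(s' | pred2 s t s') Y y s'.
    apply: eq_bigr => y _; congr (_ * _).
    rewrite (bigD1 s) /= ?eqxx // (bigD1 t) /= ?eqxx ?orbT 1?eq_sym //.
    rewrite big1 ?mulr1 // => s' /andP[/andP[/orP[]/eqP-> /eqP h1 /eqP h2]]; by [].
  rewrite -gS /e2 -(@geval_place_perm _ p r k k0 la x (pred2 s t) w x01).
  congr (geval p la _); apply/funext => i; rewrite /place /=.
  by rewrite -wu -wv !(inj_eq (@perm_inj _ w)).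
pose C := ((1 - p) ^- K) ^+ k.
have D1 : 1 <= (1 - p) ^- K by rewrite invf_ge1 ?exprn_gt0 // exprn_ile1 ?(ltW q0) // gerBl ltW.
have h0 t i z : 0 <= z <= 1 -> 0 <= h t i z <= (1 - p) ^- K.
  move=> z01; have /andP[z0 z1] := z01; have /andP[w0 w1] := weight_itv p0 z01.
  have w0' : 0 <= 1 - p * z by exact: le_trans (ltW q0) w0.
  have f0 : 0 <= (1 - p * z) / (1 - p) by rewrite divr_ge0 // ltW.
  rewrite mulr_ge0 ?exprn_ge0 //= -[leRHS]mul1r; apply: ler_pM; rewrite ?exprn_ge0 //.
    exact: exprn_ile1.
  apply: (@le_trans _ _ ((1 - p)^-1 ^+ b t i)).
    rewrite lerXn2r ?nnegrE ?invr_ge0 ?(ltW q0) //.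
    by rewrite ler_pdivrMr // mulVf // gt_eqF.
  rewrite -exprVn; apply: ler_weXn2l; last exact: bE.
  by rewrite invf_ge1 // gerBl ltW.
have Y0 t s : 0 <= Y t s.
  by apply: prodr_ge0 => i _; have /andP[] := h0 t i _ (x01 (off k0 i)).
have YC t s : Y t s <= C.
  apply: (@le_trans _ _ (\prod_(i | blk k0 i == s) (1 - p) ^- K)).
    by apply: ler_prod => i _; exact: h0.
  by rewrite prodr_const /C; apply: ler_weXn2l => //; exact: card_blk.
have g0 := geval1_gt0 p0 p1 la.
have e20 : 0 <= e2 by apply: geval_ge0.
pose n : R := r%:R.
have n0 : 0 < n by rewrite ltr0n (leq_ltn_trans _ (ltn_ord u)).
pose e := e1 / geval1 p la.
have e1E : e1 = e * geval1 p la by rewrite /e divfK // gt_eqF.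
have sumY : \sum_t P t * (\sum_s Y t s) = n * e1.
  under eq_bigr => t _ do rewrite mulr_sumr.
  rewrite exchange_big /=; under eq_bigr => s _ do rewrite E1.
  by rewrite sumr_const card_ord mulr_natl.
have sumYY : \sum_t P t * (\sum_s Y t s) ^+ 2 <= n * (C ^+ 2 * geval1 p la) + n ^+ 2 * e2.
  under eq_bigr => t _ do rewrite expr2 mulr_suml mulr_sumr.
  rewrite exchange_big /=.
  have bnd s : \sum_t P t * (Y t s * (\sum_s' Y t s')) <= C ^+ 2 * geval1 p la + n * e2.
    under eq_bigr => t _ do rewrite mulr_sumr mulr_sumr.
    rewrite exchange_big /= (bigD1 s) //=; apply: lerD.
      rewrite g1 mulr_sumr; apply: ler_sum => t _; rewrite mulrC ler_wpM2r //.
      by rewrite expr2 ler_pM.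
    apply: (@le_trans _ _ (\sum_(s' < r) e2)).
      rewrite [leRHS](bigD1 s) //= -[leLHS]add0r lerD //.
      by apply: ler_sum => s' h1; rewrite E2 // eq_sym.
    by rewrite sumr_const card_ord mulr_natl.
  apply: le_trans (ler_sum _ (fun s _ => bnd s)) _.
  rewrite sumr_const card_ord -mulr_natl -/n le_eqVlt; apply/orP; left; apply/eqP; ring.
(* the variance inequality, up to the positive factor n^2 geval1 *)
have sq : 0 <= \sum_t P t * ((\sum_s Y t s) - n * e) ^+ 2.
  by apply: sumr_ge0 => t _; rewrite mulr_ge0 // sqr_ge0.
have sqE : \sum_t P t * ((\sum_s Y t s) - n * e) ^+ 2 =
   \sum_t P t * (\sum_s Y t s) ^+ 2 - 2 * (n * e) * (n * e1) + (n * e) ^+ 2 * geval1 p la.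
  rewrite -sumY g1 !mulr_sumr -sumrB -big_split /=; apply: eq_bigr => t _; ring.
rewrite sqE in sq.
rewrite -/e -/C -(ler_pM2r g0) -(ler_pM2r n0) -(ler_pM2r n0).
move: sq sumYY; rewrite e1E -/n.
have -> : (e2 / geval1 p la + C ^+ 2 / n) * geval1 p la * n * n =
  n * (C ^+ 2 * geval1 p la) + n ^+ 2 * e2 by field; rewrite !gt_eqF.
set S := \sum_t _ => h1 h2; nra.
Qed.
End SecondMoment.

(** * Coherence and extremality *)

Section Extremality.
Variables (R : realType) (p : R).
Hypotheses (p0 : 0 < p) (p1 : p < 1).

Lemma prod_place r k (k0 : (0 < k)%N) (x : 'I_k -> R) (S : pred 'I_r) (phi : R -> R) :
  phi 1 = 1 ->
  \prod_i phi (place k0 x S i) = \prod_(s | S s) \prod_j phi (x j).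
Proof.
move=> phi1; rewrite (partition_big (blk k0) xpredT) //= [RHS]big_mkcond /=.
apply: eq_bigr => s _; rewrite (reindex_onto (unblk s) (off k0)) /=; last first.
  by move=> i /eqP <-; exact: unblkK.
rewrite (eq_bigl xpredT); last by move=> j; rewrite blk_unblk off_unblk !eqxx.
case: ifP => Ss; last by rewrite big1 // => j _; rewrite /place blk_unblk Ss.
by apply: eq_bigr => j _; rewrite /place blk_unblk Ss off_unblk.
Qed.

Definition pad k (x : 'I_k -> R) (i : nat) : R := if insub i is Some j then x j else 1.

Lemma place_pad r k (k0 : (0 < k)%N) (x : 'I_k -> R) :
  place k0 x (pred1 (ord0 : 'I_r.+1)) = (fun i => pad x i).
Proof.
apply/funext => i; rewrite /place /pad /= -val_eqE /=.
case: insubP => [j jk ij|]; last first.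
  by rewrite -leqNgt => ki; rewrite gtn_eqF // divn_gt0.
rewrite divn_small // eqxx; congr x; apply/val_inj => /=.
by rewrite modn_small // ij.
Qed.

Lemma pad_itv k (x : 'I_k -> R) i :
  (forall j, 0 <= x j <= 1) -> 0 <= pad x i <= 1.
Proof. by move=> x01; rewrite /pad; case: insubP => // _; rewrite ler01 lexx. Qed.

Definition coherent (M : forall n, intpart n -> R) : Prop :=
  (forall n, has_sum (M n) 1) /\
  (forall n mu, has_sum (fun la => M n.+1 la *
     (skew_grothendieck1 p la mu * geval1 p mu / geval1 p la)) (M n mu)).

(** All terms are nonnegative, so the extended-real sums are exactly the ones with
real value. *)
Lemma coherentP M : coherent_system p M <-> coherent M.
Proof.
have sk0 n (la : intpart n.+1) mu : 0 <= skew_grothendieck1 p la mu * geval1 p mu / geval1 p la.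
  by rewrite divr_ge0 ?mulr_ge0 ?skew_ge0 // ltW // geval1_gt0.
split=> [[h1 h2]|[h1 h2]]; split=> n.
- by have [] := h1 n.
- move=> mu; split; last exact: h2.
  by move=> la; rewrite mulr_ge0 //; have [] := h1 n.+1.
- by have [] := h1 n.
- by move=> mu; have [] := h2 n mu.
Qed.

(** The branching rule at last variable 1 inserts the coherence relation, and the
order of summation is exchanged. *)
Lemma gf_lift n (N : intpart n.+1 -> R) (N' : intpart n -> R) (x : 'I_n.+1 -> R) L :
  (forall la, 0 <= N la) ->
  (forall mu, has_sum (fun la => N la * (skew_grothendieck1 p la mu * geval1 p mu / geval1 p la)) (N' mu)) ->
  (forall i, 0 <= x i <= 1) -> x ord_max = 1 ->
  has_sum (fun mu => N' mu * (geval p mu (but_last x) / geval1 p mu)) L ->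
  has_sum (fun la => N la * (geval p la x / geval1 p la)) L.
Proof.
move=> N0 NN' x01 x1 hL.
have g1 m (la : intpart m) := geval1_gt0 p0 p1 la.
pose a mu la := N la / geval1 p la * (skew_grothendieck1 p la mu * geval p mu (but_last x)).
have ha mu : has_sum (a mu) (N' mu * (geval p mu (but_last x) / geval1 p mu)).
  rewrite mulrC.
  have r0 : 0 <= geval p mu (but_last x) / geval1 p mu.
    by rewrite divr_ge0 ?(ltW (g1 _ _)) // geval_ge0 // => i; exact: x01.
  apply: eq_has_sum (has_sumZ r0 (NN' mu)) => la; rewrite /a.
  by field; rewrite !gt_eqF ?g1.
have [c hc cL] := has_sum_fubini ha hL.
apply: eq_has_sum cL => la; apply: has_sum_uniq (hc la) _.
have w0 : 0 <= N la / geval1 p la by rewrite divr_ge0 // ltW.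
by have := has_sumZ w0 (branching1 p0 p1 la x01 x1); rewrite mulrAC mulrA.
Qed.

(** By [gf_lift], one level at a time: all appended variables equal 1. *)
Lemma coherent_gf_stable M k (x : 'I_k -> R) L N : coherent M -> (k <= N)%N ->
  (forall j, 0 <= x j <= 1) ->
  has_sum (fun la => M k la * (geval p la x / geval1 p la)) L ->
  has_sum (fun la => M N la * (geval p la (fun i : 'I_N => pad x i) / geval1 p la)) L.
Proof.
move=> [hM1 hM2] kN x01 hL; elim: N kN => [|N IH].
  rewrite leqn0 => /eqP k0; subst k; move: hL; congr has_sum; apply/funext => la.
  by congr (_ * (geval _ _ _ / _)); apply/funext => -[].
rewrite leq_eqVlt => /orP[/eqP e|kN]; last first.
  apply: (gf_lift (N' := M N)) => //.
  - exact: (hM1 N.+1).1.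
  - by move=> i; exact: pad_itv.
  - by rewrite /pad; case: insubP => // j jk /= e; move: jk; rewrite /= ltnNge -ltnS kN.
  apply: eq_has_sum (IH kN) => la; congr (_ * (geval _ _ _ / _)).
  by apply/funext => i; rewrite /but_last lift_max.
subst k; move: hL; congr has_sum; apply/funext => la.
by congr (_ * (geval _ _ _ / _)); apply/funext => i; rewrite /pad valK.
Qed.

(** The projection of M_(n+1) to level n satisfies the same generating function
identity as M_n because phi 1 = 1. *)
Lemma cube_gf_coherent (M : forall n, intpart n -> R) phi :
  taylor_bounded phi -> phi 1 = 1 -> (forall n, cube_gf p (M n) phi) -> coherent M.
Proof.
move=> tb phi1 gf.
have mass n : has_sum (M n) 1 by have := cube_gf_mass p0 p1 (gf n); rewrite phi1 expr1n.
have g1 m (la : intpart m) := geval1_gt0 p0 p1 la.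
split=> // n.
pose a (x : 'I_n -> R) la mu := M n.+1 la / geval1 p la * (skew_grothendieck1 p la mu * geval p mu x).
have sums x : (forall i, 0 <= x i <= 1) -> exists2 C : intpart n -> R,
    (forall mu, has_sum (fun la => a x la mu) (C mu)) & has_sum C (\prod_(i < n) phi (x i)).
  move=> x01; pose y (i : 'I_n.+1) := pad x i.
  have y01 i : 0 <= y i <= 1 by exact: pad_itv.
  have y1 : y ord_max = 1.
    by rewrite /y /pad; case: insubP => // j + /= e; rewrite ltnn.
  have yb : but_last y = x by apply/funext => i; rewrite /but_last /y lift_max /pad valK.
  apply: (@has_sum_fubini _ _ _ (a x) (fun la => M n.+1 la * (geval p la y / geval1 p la))).
    move=> la; have w0 : 0 <= M n.+1 la / geval1 p la.
      by rewrite divr_ge0 ?(mass n.+1).1 // ltW.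
    by have := has_sumZ w0 (branching1 p0 p1 la y01 y1); rewrite yb mulrAC mulrA.
  have := gf n.+1 y y01; rewrite big_ord_recr /= y1 phi1 mulr1.
  congr (has_sum _ _); apply: eq_bigr => i _; congr (phi _).
  by rewrite /y /pad /= valK.
have one01 (i : 'I_n) : 0 <= (1 : R) <= 1 by rewrite ler01 lexx.
have [M' hM' _] := sums (fun=> 1) one01.
suff -> : M n = M'.
  move=> mu; apply: eq_has_sum (hM' mu) => la.
  by rewrite /a /geval1; field; rewrite gt_eqF // g1.
apply: (cube_gf_uniq p0 p1 tb (gf n)) => x x01.
have [C hC CE] := sums x x01; apply: eq_has_sum CE => mu.
apply: has_sum_uniq (hC mu) _.
have r0 : 0 <= geval p mu x / geval1 p mu by rewrite divr_ge0 ?(ltW (g1 _ _)) // geval_ge0.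
rewrite mulrC; apply: eq_has_sum (has_sumZ r0 (hM' mu)) => la.
by rewrite /a -/(geval1 p mu); field; rewrite !gt_eqF ?g1.
Qed.

Lemma le_small_eq0 (d D : R) : 0 <= d -> (forall r, (1 < r)%N -> d <= D / r%:R) -> d = 0.
Proof.
move=> d0 h; apply/eqP; rewrite eq_le d0 andbT leNgt; apply/negP => dp.
(* r > D / d, and at least 2 as the hypothesis requires *)
pose r := (Num.bound (D / d)).+2.
have := h r isT; rewrite ler_pdivlMr ?ltr0n // mulrC -ler_pdivlMr // leNgt => /negP; apply.
have D0 : 0 <= D / d.
  by rewrite divr_ge0 //; have := h 2%N isT; lra.
apply: lt_le_trans (archi_boundP D0) _.
by rewrite ler_nat /r; lia.
Qed.

(** The quantity e of [second_moment] has mean psi and second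
moment at most psi^2 + D under M_N, where D = O(1/r). Its mean square distance
to psi is thus at most D under M_N and at most D / t under M1_N, and that bounds
the squared distance between psi and its mean L under M1_N. Here L does not
depend on r. *)
Lemma component_gf (M M1 : forall n, intpart n -> R) phi K t :
  phi 1 = 1 -> (forall n, cube_gf p (M n) phi) ->
  (forall n la, M n la != 0 -> narrow K la) ->
  coherent M1 -> 0 < t -> (forall n la, t * M1 n la <= M n la) ->
  forall n, cube_gf p (M1 n) phi.
Proof.
move=> phi1 gf supp cM1 t0 tM k x x01.
have [k0|k0] := posnP k.
  subst k; rewrite big_ord0; apply: eq_has_sum (cM1.1 0%N) => la.
  rewrite (_ : x = fun=> 1); last by apply/funext => -[].
  by rewrite geval_ratio1 // mulr1.
have mass n : has_sum (M n) 1 by have := cube_gf_mass p0 p1 (gf n); rewrite phi1 expr1n.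
have g1 m (la : intpart m) := geval1_gt0 p0 p1 la.
pose psi := \prod_(i < k) phi (x i).
pose Cb := (1 - p) ^- (k * k).
have Cb0 : 0 <= Cb by rewrite invr_ge0 exprn_ge0 // subr_ge0 ltW.
have [L hL _] : exists2 L, has_sum (fun la => M1 k la * (geval p la x / geval1 p la)) L & L <= Cb * 1.
  apply: (has_sum_dom _ (has_sumZ Cb0 (cM1.1 k))) => la.
  have m0 := (cM1.1 k).1 la.
  rewrite mulr_ge0 //=; last by apply: divr_ge0; [exact: geval_ge0|exact/ltW/g1].
  rewrite mulrC ler_wpM2r //.
  by have := geval_ratio_le p0 p1 la (lexx 1) x01; rewrite expr1n mulr1.
suff e : psi = L by rewrite -/psi e.
pose C := ((1 - p) ^- K) ^+ k.
suff : (L - psi) ^+ 2 = 0 by move/eqP; rewrite expf_eq0 /= subr_eq0 => /eqP.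
apply: (@le_small_eq0 _ (C ^+ 2 / t)); first exact: sqr_ge0.
case=> [//|[//|r]] _; pose N := (r.+2 * k)%N.
pose u : 'I_r.+2 := ord0; pose v : 'I_r.+2 := lift ord0 ord0.
have uv : u != v by exact: neq_lift.
pose e (la : intpart N) := geval p la (place k0 x (pred1 u)) / geval1 p la.
pose e2 (la : intpart N) := geval p la (place k0 x (pred2 u v)) / geval1 p la.
have place01 (S : pred 'I_r.+2) i : 0 <= place k0 x S i <= 1.
  by rewrite /place; case: ifP => // _; rewrite ler01 lexx.
have e0 la : 0 <= e la by apply: divr_ge0; [exact: geval_ge0|exact/ltW/g1].
have hL1 : has_sum (fun la => M1 N la * e la) L.
  rewrite /e /u place_pad; apply: coherent_gf_stable => //.
  by rewrite /N -[leqLHS]mul1n leq_mul2r orbT.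
have he : has_sum (fun la => M N la * e la) psi.
  have := gf N _ (place01 (pred1 u)).
  by rewrite (@prod_place r.+2 k k0 x (pred1 u)) // big_pred1_eq.
have he2 : has_sum (fun la => M N la * e2 la) (psi ^+ 2).
  have := gf N _ (place01 (pred2 u v)).
  rewrite (@prod_place r.+2 k k0 x (pred2 u v)) //.
  rewrite (eq_bigl (mem (pred2 u v))) //.
  by rewrite prodr_const card2 uv.
have psi0 : 0 <= psi by exact: has_sum_ge0 he.
have L0 : 0 <= L by exact: has_sum_ge0 hL.
pose D := C ^+ 2 / r.+2%:R.
have D0 : 0 <= D by rewrite divr_ge0 // sqr_ge0.
(* arranged with nonnegative terms on both sides, so that both can be summed *)
have quad la : M N la * (e la - psi) ^+ 2 + 2 * psi * (M N la * e la) <=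
    M N la * e2 la + (D + psi ^+ 2) * M N la.
  have [->|nz] := eqVneq (M N la) 0; first by rewrite !mul0r !mulr0 addr0.
  have M0 := (mass N).1 la.
  have := second_moment p0 p1 k0 uv (supp _ _ nz) x01.
  rewrite -/(e la) -/(e2 la) -/C -/D => h.
  have -> : M N la * (e la - psi) ^+ 2 + 2 * psi * (M N la * e la) =
    M N la * (e la ^+ 2 + psi ^+ 2) by ring.
  have -> : M N la * e2 la + (D + psi ^+ 2) * M N la = M N la * (e2 la + D + psi ^+ 2) by ring.
  by rewrite ler_wpM2l // lerD2r.
have Dp0 : 0 <= D + psi ^+ 2 by rewrite addr_ge0 // sqr_ge0.
have p20 : 0 <= 2 * psi by rewrite mulr_ge0.
have hrhs := has_sumD he2 (has_sumZ Dp0 (mass N)).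
have sq0 la : 0 <= M N la * (e la - psi) ^+ 2.
  by rewrite mulr_ge0 ?sqr_ge0 //; exact: (mass N).1.
have [X hX _] : exists2 X, has_sum (fun la => M N la * (e la - psi) ^+ 2) X & X <= psi ^+ 2 + (D + psi ^+ 2) * 1.
  apply: has_sum_dom hrhs => la; rewrite sq0 /=; apply: le_trans (quad la).
  by rewrite lerDl mulr_ge0 // mulr_ge0 //; exact: (mass N).1.
have XD : X <= D.
  have := has_sum_le quad (has_sumD hX (has_sumZ p20 he)) hrhs; lra.
have ti0 : 0 <= t^-1 by rewrite invr_ge0 ltW.
have M10 la : 0 <= M1 N la by exact: (cM1.1 N).1.
have [X1 hX1 X1D] : exists2 X1, has_sum (fun la => M1 N la * (e la - psi) ^+ 2) X1 & X1 <= t^-1 * X.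
  apply: has_sum_dom (has_sumZ ti0 hX) => la; rewrite mulr_ge0 ?sqr_ge0 //=.
  by rewrite [leRHS]mulrA ler_wpM2r ?sqr_ge0 // [leRHS]mulrC ler_pdivlMr // mulrC.
(* (e - L)^2 >= 0, again with nonnegative terms on both sides *)
have jensen la : 2 * L * (M1 N la * e la) + psi ^+ 2 * M1 N la <=
   M1 N la * (e la - psi) ^+ 2 + (2 * psi * (M1 N la * e la) + L ^+ 2 * M1 N la).
  rewrite -subr_ge0.
  have -> : M1 N la * (e la - psi) ^+ 2 + (2 * psi * (M1 N la * e la) + L ^+ 2 * M1 N la) -
    (2 * L * (M1 N la * e la) + psi ^+ 2 * M1 N la) = M1 N la * (e la - L) ^+ 2 by ring.
  by rewrite mulr_ge0 ?sqr_ge0.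
have L20 : 0 <= 2 * L by rewrite mulr_ge0.
have := has_sum_le jensen (has_sumD (has_sumZ L20 hL1) (has_sumZ (sqr_ge0 psi) (cM1.1 N)))
  (has_sumD hX1 (has_sumD (has_sumZ p20 hL1) (has_sumZ (sqr_ge0 L) (cM1.1 N)))).
have : t^-1 * X <= C ^+ 2 / t / r.+2%:R.
  have -> : C ^+ 2 / t / r.+2%:R = t^-1 * D by rewrite /D; ring.
  by rewrite ler_wpM2l.
move=> h1 h2; apply: le_trans h1; apply: le_trans X1D.
have -> : (L - psi) ^+ 2 =
  2 * L * L + psi ^+ 2 * 1 - (2 * psi * L + L ^+ 2 * 1) by ring.
by rewrite lerBlDr.
Qed.

Lemma prob_mass0 (m : intpart 0 -> R) la : has_sum m 1 -> m la = 1.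
Proof.
move=> m1; have e (mu : intpart 0) : mu = la by apply: eq_intpart => -[].
have : has_sum m (\sum_(mu <- [:: la]) m mu).
  by apply: has_sum_seq => // [mu|mu]; [exact: m1.1|rewrite inE (e mu) eqxx].
by rewrite big_seq1 => /has_sum_uniq/(_ m1).
Qed.

(** Each of the two components of a convex decomposition is, up to a positive
factor, bounded by the system. *)
Lemma family_extreme (A B : seq R) K : regular_gf (Phi p A B) ->
  (forall n, exists c : intpart n -> R, expands p c (Phi p A B) /\
     forall la, c la != 0 -> narrow K la) ->
  exists M : forall n, intpart n -> R,
    unique (M_family p A B) M /\ extreme_coherent_system p M.
Proof.
set phi := Phi p A B => -[[D fD] phic phi1] hc.
have tb := smooth_taylor_bounded fD.
pose c n := sval (cid (hc n)).
have Hc n : expands p (c n) phi /\ forall la, c n la != 0 -> narrow K la := svalP (cid (hc n)).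
pose M n (la : intpart n) := c n la * geval1 p la.
have gf n : cube_gf p (M n) phi by apply: expands_cube => //; case: (Hc n).
have supp n la : M n la != 0 -> narrow K la.
  by rewrite mulf_eq0 negb_or => /andP[cn _]; case: (Hc n) => _; apply.
have cM := cube_gf_coherent tb phi1 gf.
exists M; split.
  split.
    split; last by move=> n m n0; exact: cube_gf_coeffs tb (gf n) m.
    by move=> la; exact: prob_mass0 (cM.1 0%N).
  move=> M' [M'0 hM']; apply: functional_extensionality_dep => -[|n].
    by apply/funext => la; rewrite M'0; exact: prob_mass0 (cM.1 0%N).
  apply: (coeff_identity_uniq p0 p1) => m; rewrite hM' //.
  exact: cube_gf_coeffs tb (gf n.+1) m.
split; first by apply/coherentP.
move=> M1 M2 t /coherentP cM1 /coherentP cM2 /andP[t0 t1] ME.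
have main M3 s : coherent M3 -> 0 < s -> (forall n la, s * M3 n la <= M n la) -> M3 = M.
  move=> cM3 s0 le; apply: functional_extensionality_dep => n.
  apply: (cube_gf_uniq p0 p1 tb _ (gf n)).
  exact: (component_gf phi1 gf supp cM3 s0).
have u0 : 0 < 1 - t by rewrite subr_gt0.
split.
  apply: (main M1 t cM1 t0) => n la; rewrite ME lerDl mulr_ge0 ?(ltW u0) //.
  exact: (cM2.1 n).1.
apply: (main M2 (1 - t) cM2 u0) => n la; rewrite ME lerDr mulr_ge0 ?(ltW t0) //.
exact: (cM1.1 n).1.
Qed.

End Extremality.

Theorem theoremC (R : realType) (p : R) (A B : seq R)
  (hp : 0 < p < 1)
  (hA : sorted >=%R A) (hA' : {in A, forall a, p / (1 - p) < a})
  (hB : sorted >=%R B) (hB' : {in B, forall b, p <= b <= 1}) :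
  (exists M : forall n, intpart n -> R,
     unique (M_family p A [::]) M /\ extreme_coherent_system p M) /\
  (exists M : forall n, intpart n -> R,
     unique (M_family p [::] B) M /\ extreme_coherent_system p M).
Proof.
have /andP[p0 p1] := hp; split.
  apply: (family_extreme (K := size A) p0 p1); first exact: regular_gf_row.
  move=> n; have [c [hc ck]] := expands_row p0 p1 n hA'.
  by exists c; split=> // la /ck; left.
apply: (family_extreme (K := size B) p0 p1); first exact: regular_gf_column.
move=> n; have [c [hc ck]] := expands_column p0 p1 n hB'.
by exists c; split=> // la /ck; right.
Qed.
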